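(* Let $a$ be a weak composition. The Young key polynomials are generated using the words in $\mathcal{YW}(a)$ as follows: $$\hat\kappa_a = \sum_{w \in \mathcal{YW}(a)} x_w.$$
   Context: Let $n=\ell(a)$. The Young key polynomial is $\hat\kappa_a(x_1,\ldots,x_n)=\kappa_{\mathrm{rev}(a)}(x_n,\ldots,x_1)$, where $\kappa_b$ is the key polynomial (Demazure character) and $\mathrm{rev}$ denotes reversal. For a word $u$, $\mathrm{frev}(u)$ is obtained by reversing $u$ and replacing each letter $j$ by $n+1-j$. $\mathrm{key}(b)$ is the unique key (semistandard Young tableau whose columns' entry sets are nested, each containing the next) of weight $b$, and $\mathrm{std}(T)$ is the standardization of an SSYT $T$ (replace the 1's from left to right by $1,\ldots,\gamma_1$, then the 2's by $\gamma_1+1,\ldots$, etc.). $\mathcal{YW}(a)$ is the set of words $u=\cdots u^{(2)}u^{(1)}$ factored into weakly increasing row-words (possibly empty) with $u^{(i)}$ having $a_i$ letters, such that (1) $\mathrm{frev}(u)$ maps to a pair $(P,\mathrm{std}(\mathrm{key}(\mathrm{rev}(a))))$ under the column insertion of Reiner–Shimozono (''Key polynomials and a flagged Littlewood–Richardson rule''), and (2) every letter $j$ of $u^{(i)}$ satisfies $i\le j\le \ell(a)$. For a word $w$, $x_w=\prod_{\text{letters } j \text{ of } w}x_j$. *)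

(* Defs.v *)
From HB Require Import structures.
From mathcomp Require Import all_boot all_order all_fingroup all_algebra.
From mathcomp Require Import zify.
From mathcomp.multinomials Require Import mpoly.

Set Implicit Arguments.
Unset Strict Implicit.
Unset Printing Implicit Defensive.

Import GRing.Theory.
Local Open Scope ring_scope.

(* Everything is numbered from 0: the variables x_1, ..., x_n are
   'X_i with i : 'I_n, a letter j is the ordinal of value j - 1, the parts
   of a weak composition are a_0, ..., a_(n-1), and standard tableaux with N
   cells are filled with 0, ..., N - 1. *)

Section KeyPolynomials.

Variable n : nat.
Implicit Types (i j : 'I_n) (f g : {mpoly int[n]}) (b : n.-tuple nat).

Lemma divdiff_exists i j f :
  exists g, ('X_i - 'X_j) * g == f - msym (tperm i j) f.
Proof.
elim/mpolyind: f => [|c m p _ _ [h /eqP IH]].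
  by exists 0; rewrite msym0 subrr mulr0.
have keyX k : exists g, ('X_i - 'X_j) * g = 'X_k - msym (tperm i j) 'X_k.
  have -> : msym (tperm i j) 'X_k = 'X_(tperm i j k) :> {mpoly int[n]}.
    rewrite msymX tpermV; congr 'X_[_]; apply/mnmP=> l; rewrite mnmE !mnm1E.
    by rewrite (can2_eq (tpermK i j) (tpermK i j)).
  case: tpermP => [->|->|_ _]; first by exists 1; rewrite mulr1.
    by exists (-1); rewrite mulrN1 opprB.
  by exists 0; rewrite subrr mulr0.
have keyM p1 p2 : (exists g, ('X_i - 'X_j) * g = p1 - msym (tperm i j) p1) ->
    (exists g, ('X_i - 'X_j) * g = p2 - msym (tperm i j) p2) ->
    exists g, ('X_i - 'X_j) * g = p1 * p2 - msym (tperm i j) (p1 * p2).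
  move=> [g1 E1] [g2 E2]; exists (g1 * p2 + msym (tperm i j) p1 * g2).
  rewrite mulrDr mulrA E1 mulrCA E2 rmorphM mulrBl mulrBr addrA.
  by rewrite subrK.
have [g Eg] : exists g, ('X_i - 'X_j) * g = 'X_[m] - msym (tperm i j) 'X_[m].
  rewrite (mpolyXE_id _ m); pose P (q : {mpoly int[n]}) :=
    exists g, ('X_i - 'X_j) * g = q - msym (tperm i j) q.
  apply: (big_ind P) => [|p1 p2|k _]; rewrite /P; [|exact: keyM|].
    by exists 0; rewrite rmorph1 subrr mulr0.
  elim: (m k) => [|e IHe]; first by exists 0; rewrite expr0 rmorph1 subrr mulr0.
  by rewrite exprS; apply: keyM.
exists (c *: g + h); apply/eqP; rewrite mulrDr -scalerAr Eg IH msymD msymZ.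
by rewrite scalerBr opprD addrACA.
Qed.

(* (f - s f) / (x_i - x_j), where s exchanges x_i and x_j. *)
Definition divdiff i j f : {mpoly int[n]} := xchoose (divdiff_exists i j f).

Lemma divdiffP i j f :
  ('X_i - 'X_j) * divdiff i j f = f - msym (tperm i j) f.
Proof. exact/eqP/(xchooseP (divdiff_exists i j f)). Qed.

Definition demazure i j f : {mpoly int[n]} := divdiff i j ('X_i * f).

Definition swap i j b : n.-tuple nat := [tuple tnth b (tperm i j k) | k < n].

Definition ascent b : option ('I_n * 'I_n) :=
  [pick p : 'I_n * 'I_n | (p.2 == p.1.+1 :> nat)
                          && (tnth b p.1 < tnth b p.2)%N].

Definition ninv b : nat :=
  #|[set p : 'I_n * 'I_n | (p.1 < p.2)%N && (tnth b p.1 < tnth b p.2)%N]|.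

Fixpoint key_poly_rec (fuel : nat) b : {mpoly int[n]} :=
  if fuel isn't fuel'.+1 then 'X_[Multinom b] else
  if ascent b is Some (i, j)
  then demazure i j (key_poly_rec fuel' (swap i j b))
  else 'X_[Multinom b].

(* kappa_b = x^b if b is weakly decreasing, and
   kappa_b = pi_i kappa_(s_i b) if b_i < b_(i+1); the choice of the ascent i
   is immaterial by the braid relations.  The recursion is [key_polyE]. *)
Definition key_poly b : {mpoly int[n]} := key_poly_rec (ninv b) b.

Lemma ascentP b i j : ascent b = Some (i, j) ->
  (j = i.+1 :> nat) /\ (tnth b i < tnth b j)%N.
Proof. by rewrite /ascent; case: pickP => // -[k l] /andP[/eqP ? ?] [<- <-]. Qed.

Lemma ninv_swap b i j : j = i.+1 :> nat -> (tnth b i < tnth b j)%N ->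
  (ninv (swap i j b) < ninv b)%N.
Proof.
move=> ji bij; set s := tperm i j.
pose h (p : 'I_n * 'I_n) := (s p.1, s p.2).
have h_inj : injective h by move=> [? ?] [? ?] [] /perm_inj -> /perm_inj ->.
rewrite /ninv -(card_imset _ h_inj); apply: proper_card; apply/properP; split.
  apply/subsetP=> _ /imsetP[[p q] + ->]; rewrite !inE /h /= !tnth_mktuple -/s.
  case/andP=> lt_pq lt_b; rewrite lt_b andbT.
  have sE k : s k = (if k == i :> nat then j
                     else if k == j :> nat then i else k) :> nat.
    by rewrite /s permE /= !val_eqE; case: eqP => // _; case: eqP.
  have [/andP[/eqP pi /eqP qj]|] := boolP ((p == i) && (q == j)).
    by move: lt_b; rewrite pi qj /s tpermL tpermR ltnNge ltnW.
  rewrite /= in lt_pq; rewrite !sE -!val_eqE /= ji.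
  by do 4?case: eqP; move=> *; lia.
exists (i, j); first by rewrite inE /= ji ltnSn.
apply/imsetP=> -[[p q]]; rewrite inE /h /= => /andP[lt_pq _] [Ei Ej].
have Ep : p = j by apply: (@perm_inj _ s); rewrite -Ei /s tpermR.
have Eq : q = i by apply: (@perm_inj _ s); rewrite -Ej /s tpermL.
by move: lt_pq; rewrite Ep Eq ji ltnNge leqnSn.
Qed.

Lemma key_polyE b :
  key_poly b = if ascent b is Some (i, j)
               then demazure i j (key_poly (swap i j b))
               else 'X_[Multinom b].
Proof.
have stable m1 m2 c : (ninv c <= m1)%N -> (ninv c <= m2)%N ->
    key_poly_rec m1 c = key_poly_rec m2 c.
  have desc c' : ninv c' = 0%N -> ascent c' = None.
    case E: (ascent c') => [[i j]|//]; have [ji bij] := ascentP E.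
    by move: (ninv_swap ji bij) => + c0; rewrite c0.
  elim: m1 m2 c => [|m1 IH] [|m2] c //= le1 le2.
  - by rewrite desc //; apply/eqP; rewrite -leqn0.
  - by rewrite desc //; apply/eqP; rewrite -leqn0.
  case E: (ascent c) => [[i j]|//]; have [ji bij] := ascentP E.
  have lt := ninv_swap ji bij.
  by rewrite (IH m2) // -ltnS; apply: leq_trans lt _.
rewrite {1}/key_poly; case E: (ascent b) => [[i j]|]; last first.
  by case: (ninv b) => //= m; rewrite E.
have [ji bij] := ascentP E; have lt := ninv_swap ji bij.
case: (ninv b) lt => //= m lt; rewrite E /key_poly; congr demazure.
exact: stable.
Qed.

Definition young_key_poly b : {mpoly int[n]} :=
  key_poly [tuple of rev b] \mPo [tuple 'X_(rev_ord i) | i < n].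

End KeyPolynomials.

(* A tableau is the list of its columns, from left to right; each column is
   listed in increasing order (from top to bottom in English notation). *)
Definition tableau := seq (seq nat).

Definition row_le (c d : seq nat) : bool :=
  (size d <= size c)%N
  && all (fun r => nth 0%N c r <= nth 0%N d r)%N (iota 0 (size d)).

Definition is_ssyt (T : tableau) : bool :=
  all (fun c => (c != [::]) && sorted ltn c) T && sorted row_le T.

Definition is_key (T : tableau) : bool :=
  is_ssyt T && sorted (fun c d : seq nat => all (mem c) d) T.

Definition has_weight (b : seq nat) (T : tableau) : Prop :=
  forall i, count_mem i (flatten T) = nth 0%N b i.

(* The c-th column of key b is {i | b_i > c}. *)
Definition key (b : seq nat) : tableau :=
  mkseq (fun c => [seq i <- iota 0 (size b) | (c < nth 0 b i)%N])
        (\max_(m <- b) m).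

(* A letter v lying in column c becomes the number of letters smaller than v
   plus the number of letters v in the columns to the left of c. *)
Definition std (T : tableau) : tableau :=
  mkseq (fun c => [seq (count (fun w => w < v) (flatten T)
                        + count_mem v (flatten (take c T)))%N
                  | v <- nth [::] T c])
        (size T).

(* x replaces the smallest entry >= x, which is bumped; if there is none, x is
   appended at the bottom. *)
Fixpoint col_bump (x : nat) (c : seq nat) : seq nat * option nat :=
  if c isn't y :: c' then ([:: x], None) else
  if (y < x)%N then let: (d, o) := col_bump x c' in (y :: d, o)
  else (x :: c', Some y).

(* Also returns the index of the column of the new cell. *)
Fixpoint col_insert (x : nat) (T : tableau) : tableau * nat :=
  if T isn't c :: T' then ([:: [:: x]], 0%N) else
  match col_bump x c with
  | (d, None) => (d :: T', 0%N)
  | (d, Some y) => let: (U, k) := col_insert y T' in (d :: U, k.+1)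
  end.

(* Column insertion of a word into the empty tableau, starting from its last
   letter: the pair (P, Q) of the insertion and recording tableaux. *)
Fixpoint col_RS (w : seq nat) : tableau * tableau :=
  if w isn't x :: w' then ([::], [::]) else
  let: (P, Q) := col_RS w' in
  let: (P', k) := col_insert x P in
  (P', set_nth [::] Q k (rcons (nth [::] Q k) (size w'))).

Lemma row_le_subseq c d : sorted ltn c -> subseq d c -> row_le c d.
Proof.
move=> sc sdc; rewrite /row_le size_subseq //=.
apply/allP=> r; rewrite mem_iota /= add0n.
elim: c d sc sdc r => [|x c IH] [|y d] //= sc; case: eqP => [->|_] sdc.
  by move=> [|r] //= lt_r; apply: IH (path_sorted sc) sdc _ lt_r.
move=> r lt_r; apply: leq_trans (IH _ (path_sorted sc) sdc r lt_r).
have lt_rc : (r < size c)%N by apply: leq_trans lt_r (size_subseq sdc).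
have := pathP 0%N sc r lt_rc; exact: ltnW.
Qed.

Lemma mem_key b c i : (c < size (key b))%N ->
  (i \in nth [::] (key b) c) = (c < nth 0 b i)%N.
Proof.
rewrite size_mkseq => lt_c; rewrite nth_mkseq // mem_filter mem_iota /= add0n.
by case: (ltnP i (size b)) => [|/(nth_default 0%N) ->]; rewrite ?andbT ?andbF.
Qed.

Lemma nth_leq_max b i : (nth 0 b i <= \max_(m <- b) m)%N.
Proof.
have [lt_i|/(nth_default 0%N) -> //] := ltnP i (size b).
exact: (@leq_bigmax_seq _ b xpredT id _ (mem_nth 0%N lt_i)).
Qed.

Lemma lt_size_key b c :
  reflect (exists i, (c < nth 0 b i)%N) (c < size (key b))%N.
Proof.
rewrite size_mkseq; apply: (iffP idP) => [|[i lt_c]]; last first.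
  exact: leq_trans lt_c (nth_leq_max b i).
rewrite ltnNge => /bigmax_leqP_seq nle_c; case: (@hasP _ (fun m => c < m)%N b).
  by case=> m /(nthP 0%N)[i _ <-] lt_c; exists i.
move=> no_m; case: nle_c => m m_b _; rewrite leqNgt; apply/negP => lt_c.
by apply: no_m; exists m.
Qed.

Lemma key_column_sorted b c : sorted ltn (nth [::] (key b) c).
Proof.
have [lt_c|/(nth_default [::]) -> //] := ltnP c (size (key b)).
rewrite size_mkseq in lt_c; rewrite nth_mkseq //.
exact/sorted_filter/iota_ltn_sorted/ltn_trans.
Qed.

Lemma key_is_key b : is_key (key b).
Proof.
have step c : (c.+1 < size (key b))%N ->
    {subset nth [::] (key b) c.+1 <= nth [::] (key b) c}.
  by move=> lt_c i; rewrite !mem_key ?(ltnW lt_c) //; apply: ltnW.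
apply/andP; split; first (apply/andP; split).
- apply/(all_nthP [::]) => c lt_c; rewrite key_column_sorted andbT.
  have [i] := lt_size_key b c lt_c; rewrite -mem_key //.
  by case: (nth _ _ c).
- apply/(sortedP [::]) => c lt_c; apply: row_le_subseq.
    exact: key_column_sorted.
  have uniq_c := sorted_uniq ltn_trans ltnn (key_column_sorted b c).
  apply/subseq_uniqP => //; apply: (irr_sorted_eq ltn_trans ltnn).
  - exact: key_column_sorted.
  - exact/sorted_filter/key_column_sorted/ltn_trans.
  move=> i; rewrite mem_filter; apply/idP/andP => [i_d|[] //].
  by split=> //; apply: step.
by apply/(sortedP [::]) => c lt_c; apply/allP => i; apply: step.
Qed.

Lemma is_key_cons c T : is_key (c :: T) ->
  [/\ is_key T, c != [::], sorted ltn c & {subset flatten T <= c}].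
Proof.
elim: T c => [|d T IH] c; rewrite /is_key /is_ssyt /=.
  by case/andP=> /andP[/andP[/andP[-> ->] _] _] _; split=> // i; rewrite in_nil.
case/andP=> /andP[/and3P[/andP[-> ->] d_ok T_ok] /andP[_ row_T]].
case/andP=> /allP sub_dc sub_T; have key_dT : is_key (d :: T).
  by rewrite /is_key /is_ssyt /= d_ok T_ok row_T.
have [_ _ _ sub_Td] := IH d key_dT; split=> // i.
by rewrite mem_cat => /orP[/sub_dc // | /sub_Td/sub_dc].
Qed.

Lemma key_columnE T c i : is_key T ->
  (i \in nth [::] T c) = (c < count_mem i (flatten T))%N.
Proof.
elim: T c => [|d T IH] c; first by rewrite nth_nil.
case/is_key_cons=> keyT _ srt_d sub_Td.
rewrite /= count_cat (count_uniq_mem _ (sorted_uniq ltn_trans ltnn srt_d)).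
case: (boolP (i \in d)) => [i_d|i_d]; first by case: c => [|c] /=; rewrite ?IH.
have i_T : i \notin flatten T by apply: contra i_d; apply: sub_Td.
have := IH c.-1 keyT; rewrite (count_memPn i_T) ltn0 add0n => i_c.
by case: c i_c => [|c] /=; [rewrite (negPf i_d)|].
Qed.

Lemma key_has_weight b : has_weight b (key b).
Proof.
move=> i; apply/eqP; rewrite eqn_leq; apply/andP; split.
  rewrite leqNgt; apply/negP=> lt_i; move: (lt_i).
  rewrite -key_columnE ?key_is_key //.
  have [lt_b|/(nth_default [::]) -> //] := ltnP (nth 0%N b i) (size (key b)).
  by rewrite mem_key // ltnn.
case E: (nth 0 b i)%N => [//|m].
have lt_m : (m < nth 0 b i)%N by rewrite E.
by rewrite -key_columnE ?key_is_key // mem_key //; apply/lt_size_key; exists i.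
Qed.

Lemma key_unique b T : is_key T -> has_weight b T -> T = key b.
Proof.
move=> keyT wT.
have memT c i : (i \in nth [::] T c) = (i \in nth [::] (key b) c).
  by rewrite !key_columnE ?key_is_key // wT key_has_weight.
have ne U c : is_key U -> (c < size U)%N = (nth [::] U c != [::]).
  case/andP=> /andP[/(all_nthP [::]) ok _] _.
  have [/ok/andP[-> //]|/(nth_default [::]) -> //] := ltnP c (size U).
have srt U c : is_key U -> sorted ltn (nth [::] U c).
  case/andP=> /andP[/(all_nthP [::]) ok _] _.
  by have [/ok/andP[_ ->]|/(nth_default [::]) ->] := ltnP c (size U).
have col c : nth [::] T c = nth [::] (key b) c.
  apply: (irr_sorted_eq ltn_trans ltnn); rewrite ?srt ?key_is_key //.
have lt_eq c : (c < size T)%N = (c < size (key b))%N.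
  by rewrite !ne ?key_is_key // col.
apply: (@eq_from_nth _ [::]) => [|c _]; last exact: col.
by have := lt_eq (size T); have := lt_eq (size (key b)); rewrite !ltnn; lia.
Qed.

Definition frev (n : nat) (u : seq 'I_n) : seq 'I_n :=
  [seq rev_ord j | j <- rev u].

(* The factor u^(i) of u = u^(n-1) ... u^(1) u^(0), with u^(i) of length
   a_i. *)
Definition factor (n : nat) (a : n.-tuple nat) (u : seq 'I_n) (i : 'I_n) :
  seq 'I_n := nth [::] (rev (reshape (rev a) u)) i.

(* The bound j <= l(a) on the letters is enforced by their type 'I_n. *)
Definition YW (n : nat) (a : n.-tuple nat) : {set (sumn a).-tuple 'I_n} :=
  [set u : (sumn a).-tuple 'I_n |
    [&& [forall i : 'I_n, sorted (fun j k : 'I_n => j <= k)%N (factor a u i)],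
        (col_RS [seq val j | j <- frev u]).2 == std (key (rev a))
      & [forall i : 'I_n, all (fun j : 'I_n => i <= j)%N (factor a u i)]]].

Definition word_monomial (n : nat) (w : seq 'I_n) : {mpoly int[n]} :=
  \prod_(j <- w) 'X_j.

(* Main.v *)
Require Import Defs.
From mathcomp Require Import all_boot all_order all_fingroup all_algebra.
From mathcomp Require Import zify.
From mathcomp.multinomials Require Import mpoly.

(* Replace u by s, the complement j |-> n + 1 - j of its letters, and put
   b = rev a.  Then s lists the letters of frev u in their order of insertion,
   and is a sequence of n blocks of lengths b_1, ..., b_n, the letters of the
   k-th one being at most k.  The recording tableau is std (key b) exactly when
   the k-th block adds its cells to the columns 1, ..., b_k in this order.  Let
   W(b) be the set of these words.

   One shows that the sum of x^s over W(b) satisfies the recursion of key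
   polynomials.  Let b_i < b_(i+1) and let c be b with these parts exchanged.
   The crystal operators e_i and f_i, which change an unmatched bracket i + 1
   into i or conversely, do not change the shapes occurring in the insertion.
   - W(b) is a union of complete i-strings: f_i could only violate the bound on
     the i-th block, but each of its letters is smaller than some letter of the
     next block.
   - An i-string meeting W(c) is contained in W(c), or meets it only in its
     highest word.
   - Exchanging the lengths of the blocks i and i + 1 by bumping one through the
     other preserves the insertion tableau, and thus gives a bijection between
     the highest words of W(b) and of W(c): the bound on the i-th block holds
     since a highest word has no unmatched i + 1.
   As pi_i maps both the sum of a string and its highest monomial to the sum of
   the string, the sum over W(b) is the image by pi_i of the sum over W(c).
   For weakly decreasing b the only word in W(b) is 1^b_1 2^b_2 ... *)

Set Implicit Arguments.
Unset Strict Implicit.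
Unset Printing Implicit Defensive.

Implicit Types (c d s : seq nat) (T U : tableau).

(** * Column insertion and the columns of the new cells *)

Definition ins T (x : nat) : tableau := (col_insert x T).1.
Definition idx T (x : nat) : nat := (col_insert x T).2.
Definition insw T s : tableau := foldl ins T s.
(** A new cell always ends its column, so these indices determine the recording tableau. *)
Fixpoint cols T s : seq nat :=
  if s is x :: s' then idx T x :: cols (ins T x) s' else [::].

Notation valid := (all (fun c : seq nat => (c != [::]) && sorted ltn c)).

Lemma ins_cons c T x : ins (c :: T) x =
  (col_bump x c).1 :: (if (col_bump x c).2 is Some y then ins T y else T).
Proof.
rewrite /ins /=; case: (col_bump x c) => d [y|] //=.
by case: (col_insert y T).
Qed.

Lemma idx_cons c T x : idx (c :: T) x =
  if (col_bump x c).2 is Some y then (idx T y).+1 else 0.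
Proof.
rewrite /idx /=; case: (col_bump x c) => d [y|] //=.
by case: (col_insert y T).
Qed.

Lemma insw_cat T s1 s2 : insw T (s1 ++ s2) = insw (insw T s1) s2.
Proof. exact: foldl_cat. Qed.

Lemma cols_cat T s1 s2 : cols T (s1 ++ s2) = cols T s1 ++ cols (insw T s1) s2.
Proof. by elim: s1 T => //= x s1 IH T; rewrite IH. Qed.

Lemma size_cols T s : size (cols T s) = size s.
Proof. by elim: s T => //= x s IH T; rewrite IH. Qed.

Lemma bump_skip x c1 c2 : all (fun y => y < x) c1 ->
  col_bump x (c1 ++ c2) = (c1 ++ (col_bump x c2).1, (col_bump x c2).2).
Proof.
elim: c1 => [|y c1 IH] /=; first by case: (col_bump x c2).
by case/andP=> -> /IH ->.
Qed.

Lemma bump_prefix x c1 c2 : ~~ all (fun y => y < x) c1 ->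
  col_bump x (c1 ++ c2) = ((col_bump x c1).1 ++ c2, (col_bump x c1).2).
Proof.
elim: c1 => [|y c1 IH] //=; case: ltnP => //= _ /IH ->.
by case: (col_bump x c1).
Qed.

Lemma bump_hit x y c1 c2 : all (fun z => z < x) c1 -> x <= y ->
  col_bump x (c1 ++ y :: c2) = (c1 ++ x :: c2, Some y).
Proof. by move=> h xy; rewrite bump_skip //= ltnNge xy. Qed.

Variant bump_spec x c : seq nat * option nat -> Prop :=
| BumpNone of all (fun z => z < x) c : bump_spec x c (rcons c x, None)
| BumpSome c1 y c2 of c = c1 ++ y :: c2 & all (fun z => z < x) c1 & x <= y :
    bump_spec x c (c1 ++ x :: c2, Some y).

Lemma bumpP x c : bump_spec x c (col_bump x c).
Proof.
case: (boolP (all (fun z => z < x) c)) => h.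
  by rewrite -{2}[c]cats0 bump_skip //= cats1; constructor.
have hh : has (fun z => x <= z) c.
  by move: h; rewrite -has_predC (eq_has (a2 := fun z => x <= z)) // => z /=; rewrite -leqNgt.
case: (split_find hh) => y c1 c2 /= xy; rewrite cat_rcons => h1.
have h2 : all (fun z => z < x) c1.
  apply/allP=> z zc1; rewrite ltnNge; apply/negP => xz.
  by move/hasP: h1; apply; exists z.
by rewrite bump_hit //; econstructor.
Qed.

Lemma sorted_ltn_mid (c1 : seq nat) y c2 : sorted ltn (c1 ++ y :: c2) =
  [&& sorted ltn c1, all (fun z => z < y) c1, sorted ltn c2 & all (fun z => y < z) c2].
Proof.
rewrite (sorted_pairwise ltn_trans) pairwise_cat /= -!(sorted_pairwise ltn_trans) allrel_consr.
case: (sorted ltn c1); rewrite ?andbF //=.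
case: (boolP (all (fun z => z < y) c1)) => //= h1.
case: (boolP (all (ltn y) c2)) => h2 /=; rewrite ?andbF //= andbT.
suff -> : allrel ltn c1 c2 by [].
apply/allrelP => a b /(allP h1) /= ay /(allP h2) /= yb; exact: ltn_trans yb.
Qed.

Lemma sorted_ltn_rcons c x : sorted ltn (rcons c x) = sorted ltn c && all (fun z => z < x) c.
Proof. by rewrite -cats1 sorted_ltn_mid /= !andbT. Qed.

Lemma bump_sorted x c : sorted ltn c -> sorted ltn (col_bump x c).1.
Proof.
case: bumpP => [h|c1 y c2 -> h xy] /=; first by rewrite sorted_ltn_rcons h => ->.
rewrite !sorted_ltn_mid h => /and4P[-> _ -> h2] /=.
by apply: sub_all h2 => z; apply: leq_ltn_trans.
Qed.

Lemma bump_neq0 x c : (col_bump x c).1 != [::].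
Proof. by case: bumpP => [_|c1 y c2 _ _ _] /=; [case: c|case: c1]. Qed.

Lemma ins_valid T x : valid T -> valid (ins T x).
Proof.
elim: T x => [|c T IH] x //= /andP[/andP[_ hc] hT].
rewrite ins_cons /= bump_neq0 bump_sorted //=.
by case: (col_bump x c).2 => [y|] //; apply: IH.
Qed.

Lemma insw_valid T s : valid T -> valid (insw T s).
Proof. by elim: s T => //= x s IH T /(ins_valid x) /IH. Qed.

Lemma size_col_ins T x k :
  size (nth [::] (ins T x) k) = size (nth [::] T k) + (idx T x == k).
Proof.
elim: T x k => [|c T IH] x k; first by case: k => [|[|k]].
rewrite ins_cons idx_cons; case: bumpP => [h|c1 y c2 -> h xy] /=; case: k => [|k] /=.
- by rewrite size_rcons addn1.
- by rewrite addn0.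
- by rewrite !size_cat /= addn0.
- by rewrite IH eqSS.
Qed.

Lemma size_col_insw T s k :
  size (nth [::] (insw T s) k) = size (nth [::] T k) + count_mem k (cols T s).
Proof.
elim: s T => [|x s IH] T; first by rewrite addn0.
by rewrite /= IH size_col_ins addnA.
Qed.

Lemma cols_perm T s s' : insw T s = insw T s' -> perm_eq (cols T s) (cols T s').
Proof.
move=> E; apply/allP => k _ /=; rewrite -(eqn_add2l (size (nth [::] T k))).
by rewrite -!size_col_insw E.
Qed.

Lemma bump_perm x c : perm_eq (x :: c)
  (if (col_bump x c).2 is Some y then y :: (col_bump x c).1 else (col_bump x c).1).
Proof.
case: bumpP => [_|c1 y c2 -> _ _] /=; first by rewrite perm_sym perm_rcons.
apply/seq.permP => a /=; rewrite !count_cat /=; lia.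
Qed.

(** The columns are read from right to left because a letter appended to the word first meets the
    leftmost column, which bumps a letter towards the columns read before it. *)
Definition reading T := flatten (rev T).

Lemma reading_cons c T : reading (c :: T) = reading T ++ c.
Proof. by rewrite /reading rev_cons flatten_rcons. Qed.

Lemma reading_ins T x : perm_eq (reading (ins T x)) (x :: reading T).
Proof.
elim: T x => [|c T IH] x //.
rewrite ins_cons !reading_cons -cat_cons -[x :: _]cat1s -catA.
apply/seq.permP => a; have /seq.permP/(_ a) := bump_perm x c.
case: (col_bump x c).2 => [y|]; rewrite !count_cat /=; last lia.
by have /seq.permP/(_ a) := IH y => /=; lia.
Qed.

Lemma reading_insw T s : perm_eq (reading (insw T s)) (reading T ++ s).
Proof.
elim: s T => [|x s IH] T /=; first by rewrite cats0.
apply: perm_trans (IH _) _; apply/seq.permP => a.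
by have /seq.permP/(_ a) := reading_ins T x; rewrite !count_cat /=; lia.
Qed.

Lemma bump_lt x x' c : x < x' -> sorted ltn c ->
  match (col_bump x c).2, (col_bump x' (col_bump x c).1).2 with
  | None, Some _ => false
  | Some y, Some y' => y < y'
  | _, _ => true end.
Proof.
move=> xx' sc; case: bumpP => [h|c1 y c2 E h xy] /=.
  rewrite -[rcons c x]cats0 bump_skip //= all_rcons xx' /=.
  by apply: sub_all h => z hz; apply: ltn_trans hz xx'.
move: sc; rewrite E sorted_ltn_mid => /and4P[_ _ _ h2].
rewrite -cat_rcons bump_skip; last first.
  rewrite all_rcons xx' /=; by apply: sub_all h => z hz; apply: ltn_trans hz xx'.
case: bumpP => [//|c3 y' c4 E2 _ _] /=.
by have := allP h2 y'; rewrite E2 mem_cat mem_head orbT; apply.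
Qed.

Lemma bump_ge x x' c : x' <= x -> sorted ltn c ->
  match (col_bump x c).2, (col_bump x' (col_bump x c).1).2 with
  | _, None => false
  | Some y, Some y' => y' <= y
  | _, _ => true end.
Proof.
move=> xx' sc; case: bumpP => [h|c1 y c2 E h xy] /=.
  by case: bumpP => //; rewrite all_rcons ltnNge xx'.
case: (boolP (all (fun z => z < x') c1)) => h'.
  by rewrite bump_hit.
rewrite bump_prefix //=; move: h'; case: bumpP => [->//|c3 y' c4 E2 h3 xy' _] /=.
have : y' < x by apply: (allP h); rewrite E2 mem_cat mem_head orbT.
by move/ltnW/leq_trans; apply.
Qed.

Lemma idx_lt T x x' : x < x' -> valid T -> idx (ins T x) x' <= idx T x.
Proof.
elim: T x x' => [|c T IH] x x' xx' /=.
  by move=> _; rewrite /idx /= xx'.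
case/andP=> /andP[_ sc] hT; rewrite ins_cons !idx_cons.
have := bump_lt xx' sc; case: (col_bump x c) => d o /=.
case: (col_bump x' d).2 o => [y'|] [y|] //= yy'.
by rewrite ltnS; apply: IH.
Qed.

Lemma idx_ge T x x' : x' <= x -> valid T -> idx T x < idx (ins T x) x'.
Proof.
elim: T x x' => [|c T IH] x x' xx' /=.
  by move=> _; rewrite /idx /ins /= [x < x']ltnNge xx'.
case/andP=> /andP[_ sc] hT; rewrite ins_cons !idx_cons.
have := bump_ge xx' sc; case: (col_bump x c) => d o /=.
case: (col_bump x' d).2 o => [y'|] [y|] //= yy'.
by rewrite ltnS; apply: IH.
Qed.

(** In every column the letters bumped by two successive insertions compare as the inserted letters
    do ([bump_lt], [bump_ge]). Hence the new cell moves strictly to the right exactly when the next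
    letter is at most the previous one. *)
Lemma cols_row T s : valid T -> sorted ltn (cols T s) = sorted geq s.
Proof.
elim: s T => [|x [|x' s] IH] T hT //; rewrite [RHS]/=.
rewrite -[path geq x' s]/(sorted geq (x' :: s)) -(IH (ins T x)); last exact: ins_valid.
rewrite [LHS]/=; congr andb; case: (leqP x' x) => xx'.
  by rewrite idx_ge.
by apply/negbTE; rewrite -leqNgt idx_lt.
Qed.

Lemma bump_inj x x' c c' : sorted ltn c -> sorted ltn c' ->
  col_bump x c = col_bump x' c' -> x = x' /\ c = c'.
Proof.
move=> sc sc'; case: bumpP => [h|c1 y c2 E h xy]; case: bumpP => [h'|c1' y' c2' E' h' xy'] //.
  by case=> /rcons_inj [-> ->].
case=> E1 Ey; rewrite -Ey {y' Ey} in xy' E'.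
(* If v stood strictly to the right of u, it would belong to a2, whose entries exceed y, against v
   <= y. Applied both ways, this shows that the replaced positions agree. *)
have H : forall u v a a2 b b2, sorted ltn (a ++ y :: a2) -> sorted ltn (b ++ y :: b2) ->
   u <= y -> v <= y -> all (fun z => z < u) a -> a ++ u :: a2 = b ++ v :: b2 -> size b <= size a.
  move=> u v a a2 b b2 s1 s2 uy vy hu EE.
  rewrite leqNgt; apply/negP => lt.
  have Ea : nth 0 (a ++ u :: a2) (size b) = v by rewrite EE nth_cat ltnn subnn.
  move: s1; rewrite sorted_ltn_mid => /and4P[_ _ _ hh].
  have vm : v \in a2.
    have lt2 : size b - size a - 1 < size a2.
      have := congr1 size EE; rewrite !size_cat /=; lia.
    rewrite -Ea nth_cat ltnNge ltnW //=.
    have -> : size b - size a = (size b - size a - 1).+1 by lia.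
    exact: mem_nth.
  by have := allP hh v vm; rewrite ltnNge vy.
have es : size c1 = size c1'.
  apply/eqP; rewrite eqn_leq; apply/andP; split.
    by apply: (H x' x c1' c2' c1 c2) => //; rewrite -?E -?E'.
  by apply: (H x x' c1 c2 c1' c2') => //; rewrite -?E -?E'.
by move/eqP: E1; rewrite eqseq_cat // eqseq_cons => /and3P[/eqP e1 /eqP e2 /eqP e3];
  rewrite E E' e1 e2 e3.
Qed.

Lemma ins_inj T T' x x' : valid T -> valid T' -> ins T x = ins T' x' ->
  idx T x = idx T' x' -> x = x' /\ T = T'.
Proof.
elim: T T' x x' => [|c T IH] [|c' T'] x x' //=.
- by move=> _ _; rewrite /ins /= => -[->].
- move=> _ /andP[/andP[c0 _] _]; rewrite ins_cons idx_cons /ins /idx /=.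
  case: bumpP => //= _ [] /esym; case: c' c0 => //= a [|] //.
- move=> /andP[/andP[c0 _] _] _; rewrite ins_cons idx_cons /ins /idx /=.
  case: bumpP => //= _ []; case: c c0 => //= a [|] //.
case/andP=> /andP[_ sc] hT /andP[/andP[_ sc'] hT'].
rewrite !ins_cons !idx_cons => -[].
have := @bump_inj x x' c c' sc sc'.
case: (col_bump x c) => d [y|]; case: (col_bump x' c') => d' [y'|] //= H E.
  move=> E1 [E2]; have [ey eT] := IH _ _ _ hT hT' E1 E2.
  by rewrite E ey in H; have [-> ->] := H erefl; rewrite eT.
by move=> E1 _; rewrite E in H; have [-> ->] := H erefl; rewrite E1.
Qed.

(** Injectivity of the correspondence: the last column index tells which cell to remove, and
    [ins_inj] undoes the last insertion. *)
Lemma insw_inj s s' : insw [::] s = insw [::] s' -> cols [::] s = cols [::] s' -> s = s'.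
Proof.
elim/last_ind: s s' => [|s x IH] s'; first by case: s'.
case/lastP: s' => [|s' x']; first by rewrite -cats1 cols_cat /= => _; case: (cols _ _).
rewrite -!cats1 !insw_cat !cols_cat /= => E.
rewrite !cats1 => /rcons_inj[Ec Ei].
have [-> Es] := ins_inj (@insw_valid [::] s isT) (@insw_valid [::] s' isT) E Ei.
by rewrite (IH s').
Qed.

(** * Knuth relations and their invariance under insertion *)

Fixpoint bumpw c s : seq nat * seq nat :=
  if s is x :: s' then
    let: (d, o) := col_bump x c in
    let: (d', o') := bumpw d s' in (d', seq_of_opt o ++ o')
  else (c, [::]).

Lemma bumpw_cons c x s : bumpw c (x :: s) =
  ((bumpw (col_bump x c).1 s).1,
   seq_of_opt (col_bump x c).2 ++ (bumpw (col_bump x c).1 s).2).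
Proof. by rewrite /=; case: (col_bump x c) => d o; case: (bumpw d s). Qed.

Lemma insw_cons c T s : insw (c :: T) s = (bumpw c s).1 :: insw T (bumpw c s).2.
Proof.
elim: s c T => [|x s IH] c T //.
rewrite [LHS]/= ins_cons IH bumpw_cons /=.
by case: (col_bump x c).2.
Qed.

Lemma bump_hd_lt y x c : y < x ->
  col_bump x (y :: c) = (y :: (col_bump x c).1, (col_bump x c).2).
Proof. by move=> /= ->; case: (col_bump x c). Qed.

Lemma bump_hd_ge y x c : x <= y -> col_bump x (y :: c) = (x :: c, Some y).
Proof. by move=> /=; rewrite ltnNge => ->. Qed.

#[local] Arguments col_bump : simpl never.

(* Knuth relations for words read in the order of insertion. *)
Variant knuth : seq nat -> seq nat -> Prop :=
| Knuth1 x y z of x <= y & y < z : knuth [:: y; z; x] [:: y; x; z]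
| Knuth2 x y z of x < y & y <= z : knuth [:: z; x; y] [:: x; z; y].

Definition tail_gt y (o : option nat) := if o is Some z then y < z else true.

Lemma bump_out_mem x c : if (col_bump x c).2 is Some z then z \in c else true.
Proof. by case: bumpP => //= c1 y c2 -> _ _; rewrite mem_cat mem_head orbT. Qed.

Lemma bump_out_gt y x c : all (ltn y) c -> tail_gt y (col_bump x c).2.
Proof.
move=> h; have := bump_out_mem x c; case: (col_bump x c).2 => [z|] //=.
exact: (allP h).
Qed.

Lemma bump_all_gt y x c : all (ltn y) c -> y < x -> all (ltn y) (col_bump x c).1.
Proof.
move=> h xy; apply/allP=> z; have /perm_mem/(_ z) := bump_perm x c.
case: (col_bump x c).2 => [w|]; rewrite !inE => E zd.
  by have := orbT (z == w); rewrite -[X in (_ || X)]zd -E => /orP[/eqP->|/(allP h)].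
by rewrite zd in E; move/orP: E => [/eqP ->|/(allP h)].
Qed.

(** A column passes a Knuth relation, in some direction, to the words that it bumps out, or makes
    these words equal. A first entry smaller than the three letters is skipped and the induction
    applies; otherwise its position relative to the larger letters separates the cases. *)
Lemma knuth_col c s s' : sorted ltn c -> knuth s s' ->
  (bumpw c s).1 = (bumpw c s').1 /\
  ((bumpw c s).2 = (bumpw c s').2 \/ knuth (bumpw c s).2 (bumpw c s').2 \/
   knuth (bumpw c s').2 (bumpw c s).2).
Proof.
move=> sc [a b e ab be|a b e ab be]; rewrite !bumpw_cons /=.
- elim: c sc => [|y c IH] sc.
    have ae : a < e by exact: leq_ltn_trans be.
    rewrite /col_bump /= be /= [b < a]ltnNge ab /= ae /= .
    by split=> //; left.
  have [yc sc'] : all (ltn y) c /\ sorted ltn c.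
    by move: sc; rewrite /= (path_sortedE ltn_trans) => /andP.
  have {IH} := IH sc'.
  case: (ltnP y a) => ya.
    have yb : y < b by exact: leq_trans ab.
    have ye : y < e by exact: ltn_trans be.
    rewrite ?bump_hd_lt //= ?bump_hd_lt //= ?bump_hd_lt //= => -[-> H]; by [].
  case: (leqP b y) => yb _.
    rewrite (bump_hd_ge _ yb) /= (bump_hd_lt _ be) (bump_hd_ge _ ab) /=.
    rewrite (bump_hd_ge _ ab) (bump_hd_lt c (leq_ltn_trans ab be)) /=.
    split=> //; have := @bump_out_gt y e c yc; case: (col_bump e c).2 => [o|] /= H; last by left.
    by right; left; constructor.
  have ye := ltn_trans yb be.
  rewrite (bump_hd_lt _ yb) /= (bump_hd_lt _ ye) /= !(bump_hd_ge _ ya) /=.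
  rewrite (bump_hd_lt _ (leq_ltn_trans ab be)) /=.
  split=> //; have := @bump_out_gt y b c yc.
  have := bump_lt be sc'; case: (col_bump b c) => d o /=.
  case: (col_bump e d).2 => [oe|]; case: o => [ob|] //= h1 h2.
  - by right; left; constructor => //; exact: ltnW.
  - by left.
  - by left.
elim: c sc => [|y c IH] sc.
  have eb : (e < b) = false by rewrite ltnNge be.
  rewrite /col_bump /= [e < a]ltnNge (ltnW (leq_trans ab be)) /= ab /= (leq_trans ab be) /= eb ab /=.
  by split=> //; left.
have [yc sc'] : all (ltn y) c /\ sorted ltn c.
  by move: sc; rewrite /= (path_sortedE ltn_trans) => /andP.
have ae : a < e by exact: leq_trans be.
have {IH} := IH sc'.
case: (ltnP y a) => ya.
  have yb : y < b by exact: ltn_trans ab.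
  have ye : y < e by exact: ltn_trans ae.
  rewrite ?bump_hd_lt //= ?bump_hd_lt //= ?bump_hd_lt //= => -[-> H]; by [].
case: (leqP e y) => ye _.
  rewrite (bump_hd_ge _ ye) (bump_hd_ge _ ya) /= (bump_hd_ge _ (ltnW ae)) /= (bump_hd_lt _ ab).
  rewrite (bump_hd_lt _ ae) /= (bump_hd_lt _ ab) /=.
  case: c sc yc sc' => [|t c] sc yc sc' /=; rewrite /col_bump /=.
    by rewrite [e < b]ltnNge be /=; split=> //; left.
  have yt : y < t by have := allP yc t (mem_head _ _).
  rewrite [t < b]ltnNge (leq_trans be (leq_trans ye (ltnW yt))) /=.
  rewrite [t < e]ltnNge (leq_trans ye (ltnW yt)) /= [e < b]ltnNge be /=.
  split=> //; right; right; constructor => //.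
rewrite (bump_hd_lt _ ye) (bump_hd_ge _ ya) /= (bump_hd_ge _ ya) /=.
rewrite (bump_hd_lt _ ab) (bump_hd_lt _ ae) /= (bump_hd_lt _ ab) /=.
split=> //; have := @bump_out_gt y b (col_bump e c).1.
have := bump_ge be sc'; have := @bump_out_gt y e c yc.
have := @bump_all_gt y e c yc ye.
case: (col_bump e c) => d o /= hd.
case: (col_bump b d).2 => [ob|]; case: o => [oe|] //= h1 h2 /(_ hd) h3.
  by right; left; constructor.
by left.
Qed.

(* The equality of the actions on all tableaux replaces the congruence that the
   Knuth relations generate. *)
Definition plactic s s' := forall T, valid T -> insw T s = insw T s'.

Lemma knuth_plactic s s' : knuth s s' -> plactic s s'.
Proof.
move=> k T; elim: T s s' k => [|c T IH] s s' k.
  move=> _; case: k => x y z xy yz; rewrite /insw /ins /=.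
    rewrite /col_bump /= yz /= [y < x]ltnNge xy /= /col_bump /= [y < x]ltnNge xy.
    by rewrite (leq_ltn_trans xy yz) /= /col_bump.
  have xz := leq_trans xy yz.
  rewrite /col_bump /= [z < x]ltnNge (ltnW xz) /= xz /= /col_bump /= xy /= [z < y]ltnNge yz.
  by rewrite /= /col_bump.
move=> /= /andP[/andP[_ sc] hT]; rewrite !insw_cons.
have [-> [->|[h|h]]] := knuth_col sc k => //; first by rewrite (IH _ _ h).
by rewrite (IH _ _ h).
Qed.

Lemma plactic_sym s s' : plactic s s' -> plactic s' s.
Proof. by move=> h T /h. Qed.

Lemma plactic_trans s1 s2 s3 : plactic s1 s2 -> plactic s2 s3 -> plactic s1 s3.
Proof. by move=> h1 h2 T hT; rewrite h1 // h2. Qed.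

Lemma plactic_cat s1 s2 s1' s2' : plactic s1 s1' -> plactic s2 s2' ->
  plactic (s1 ++ s2) (s1' ++ s2').
Proof.
by move=> h1 h2 T hT; rewrite !insw_cat h1 // h2 //; apply: insw_valid.
Qed.

Lemma plactic_perm s s' : plactic s s' -> perm_eq s s'.
Proof.
move=> /(_ [::] isT) E; rewrite -[s]/(reading [::] ++ s) -[s']/(reading [::] ++ s').
apply: perm_trans (reading_insw _ _); rewrite -E perm_sym; exact: reading_insw.
Qed.

(** * Bumping one row through another *)

Lemma plactic_pass_l y z V W : y < z -> all (leq z) V -> sorted geq V ->
  plactic (y :: V ++ z :: W) (V ++ y :: z :: W).
Proof.
move=> yz; elim: V => [|v V IH] //= /andP[zv hV] sV.
(* The letter b following v is the witness y < b <= v that lets y move past v by a Knuth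
   relation. *)
have [b [W' E ybv]] : exists b, exists2 W', V ++ z :: W = b :: W' & y < b <= v.
  case: V hV sV {IH} => [|b V] /=; first by exists z, W; rewrite ?yz.
  by move=> /andP[zb _] /andP[bv _]; exists b, (V ++ z :: W) => //; rewrite (leq_trans yz zb).
apply: (@plactic_trans _ (v :: y :: V ++ z :: W)).
  rewrite E -[[:: _, _, _ & _]]/([:: y; v; b] ++ W') -[X in plactic _ X]/([:: v; y; b] ++ W').
  apply: plactic_cat => //; apply/plactic_sym/knuth_plactic.
  by case/andP: ybv; constructor.
rewrite -[v :: _]/([:: v] ++ _) -[v :: V ++ _]/([:: v] ++ _).
apply: plactic_cat => //; apply: IH => //; exact: path_sorted sV.
Qed.

Lemma plactic_pass_r y z V : y < z -> sorted geq (y :: V) ->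
  plactic (y :: z :: V) (y :: V ++ [:: z]).
Proof.
elim: V y => [|v V IH] y yz //= /andP[vy sV].
apply: (@plactic_trans _ (y :: v :: z :: V)).
  rewrite -[[:: _, _, _ & _]]/([:: y; z; v] ++ V) -[X in plactic _ X]/([:: y; v; z] ++ V).
  by apply: plactic_cat => //; apply/knuth_plactic; constructor.
rewrite -[y :: _]/([:: y] ++ _) -[X in plactic _ X]/([:: y] ++ _).
by apply: plactic_cat => //; apply: IH => //; apply: leq_ltn_trans yz.
Qed.

(* Either y bumps z out of the row V2 ++ z :: V1, or z bumps y out of the row
   V2 ++ y :: V1. *)
Lemma plactic_row y z V2 V1 : y < z -> sorted geq V2 -> all (leq z) V2 ->
  sorted geq (y :: V1) -> plactic (y :: V2 ++ z :: V1) (V2 ++ y :: V1 ++ [:: z]).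
Proof.
move=> yz s2 h2 s1; apply: plactic_trans (plactic_pass_l _ yz h2 s2) _.
by apply: plactic_cat => //; apply: plactic_pass_r.
Qed.

Lemma sorted_geq_mid (c1 : seq nat) y c2 : sorted geq (c1 ++ y :: c2) =
  [&& sorted geq c1, all (leq y) c1, sorted geq c2 & all (geq y) c2].
Proof.
have tr : transitive geq by move=> a b e h1 h2; exact: leq_trans h2 h1.
rewrite (sorted_pairwise tr) pairwise_cat /= -!(sorted_pairwise tr) allrel_consr.
case: (sorted geq c1); rewrite ?andbF //=.
rewrite -/(all (leq y) c1); case: (boolP (all (leq y) c1)) => //= h1.
case: (boolP (all (geq y) c2)) => h2 /=; rewrite ?andbF //= andbT.
suff -> : allrel geq c1 c2 by [].
apply/allrelP => a b /(allP h1) /= ay /(allP h2) /= yb; exact: leq_trans ay.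
Qed.

Lemma sorted_geq_cons y c : sorted geq (y :: c) = all (geq y) c && sorted geq c.
Proof. by rewrite -[_ :: _]/([::] ++ y :: c) sorted_geq_mid /= andbC. Qed.

Lemma sorted_geq_rcons c y : sorted geq (rcons c y) = sorted geq c && all (leq y) c.
Proof. by rewrite -cats1 sorted_geq_mid /= !andbT. Qed.

Lemma row_bump y V : sorted geq V ->
  all (geq y) V \/
  exists V1 z V2, [/\ V = V2 ++ z :: V1, y < z, all (leq z) V2 & all (geq y) V1].
Proof.
elim: V => [|v V IH]; first by left.
rewrite sorted_geq_cons => /andP[hv sV]; case: (IH sV) => [h|[V1 [z [V2 [E yz h2 h1]]]]].
  case: (leqP v y) => vy; first by left; rewrite /= vy.
  by right; exists V, v, [::].
right; exists V1, z, (v :: V2); split=> //=; first by rewrite E.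
by rewrite h2 andbT; apply: (allP hv); rewrite E mem_cat mem_head orbT.
Qed.

Lemma row_bump' z V : sorted geq V ->
  all (leq z) V \/
  exists V1 y V2, [/\ V = V2 ++ y :: V1, y < z, all (leq z) V2 & all (geq y) V1].
Proof.
elim: V => [|v V IH]; first by left.
rewrite sorted_geq_cons => /andP[hv sV]; case: (leqP z v) => vz; last first.
  by right; exists V, v, [::].
case: (IH sV) => [h|[V1 [y [V2 [E yz h2 h1]]]]]; first by left; rewrite /= vz.
by right; exists V1, y, (v :: V2); split=> //=; rewrite ?E ?vz.
Qed.

(** Insert the letters of U, from the last one, into the row V: each is put in front of the row or
    bumps a larger letter, which joins Z. The bound t carries the induction: applied with t = z, it
    shows that the letters bumped after z are at least z, so that Z is a row. If W is no longer than
    V, each letter of U has bumped a larger one. *)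
Lemma rows_exchange_l (U V : seq nat) t : sorted geq U -> sorted geq V ->
  (forall z y, z \in V -> y \in U -> y < z -> t <= z) ->
  exists W Z, [/\ plactic (U ++ V) (W ++ Z), sorted geq W, sorted geq Z, all (leq t) Z &
    size V <= size W /\ (size V = size W -> forall y, y \in U -> has (ltn y) V)].
Proof.
elim/last_ind: U V t => [|U y IH] V t sU sV h; first by exists V, [::]; rewrite cats0.
move: sU; rewrite sorted_geq_rcons => /andP[sU hU].
case: (row_bump y sV) => [hV|[V1 [z [V2 [E yz h2 h1]]]]].
  have sV' : sorted geq (y :: V) by rewrite sorted_geq_cons hV sV.
  have [|W [Z [k sW sZ hZ [szW _]]]] := IH (y :: V) t sU sV'.
    move=> z x; rewrite inE => /orP[/eqP -> /(allP hU)|zV xU].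
      by rewrite leqNgt => /negbTE ->.
    by apply: h zV _; rewrite mem_rcons inE xU orbT.
  exists W, Z; rewrite cat_rcons; split=> //.
  by split=> [|e]; [exact: ltnW | move: szW; rewrite /= e ltnn].
move: (sV); rewrite E sorted_geq_mid => /and4P[s2 _ s1 hz1].
have sV' : sorted geq (V2 ++ y :: V1).
  rewrite sorted_geq_mid s2 s1 h1 !andbT /=; apply: sub_all h2 => w; exact/leq_trans/ltnW.
have [|W [Z [k sW sZ hZ [szW hW]]]] := IH (V2 ++ y :: V1) z sU sV'.
  move=> w x; rewrite mem_cat inE orbCA => /orP[/eqP->|/orP[/(allP h2) //|/(allP h1) /= wy]] /(allP hU) /= yx.
    by rewrite ltnNge yx.
  by rewrite ltnNge (leq_trans wy yx).
exists W, (rcons Z z); split=> //.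
- rewrite -!cats1 -!catA; apply: plactic_trans (_ : plactic _ (U ++ (V2 ++ y :: V1 ++ [:: z]))) _.
    apply: plactic_cat => //; apply: plactic_row => //.
    by rewrite sorted_geq_cons h1.
  have -> : U ++ V2 ++ y :: V1 ++ [:: z] = (U ++ V2 ++ y :: V1) ++ [:: z] by rewrite -!catA.
  by rewrite (catA W); apply: plactic_cat.
- by rewrite sorted_geq_rcons sZ.
- rewrite all_rcons; have tz : t <= z.
    by apply: (h z y); rewrite ?E ?mem_rcons ?mem_cat ?mem_head ?orbT.
  rewrite tz; apply: sub_all hZ => w; exact: leq_trans.
split; first by move: szW; rewrite !size_cat.
move=> e x; rewrite mem_rcons inE => /orP[/eqP ->|xU].
  by apply/hasP; exists z; rewrite ?mem_cat ?mem_head ?orbT.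
have e' : size (V2 ++ y :: V1) = size W by rewrite -e !size_cat.
have := hW e' x xU; rewrite !has_cat /= => /or3P[->//|xy|->]; rewrite ?orbT //.
by have := allP hU x xU; rewrite leqNgt xy.
Qed.

(** The mirror image: the letters of V, from the first one, enter the row U at its end or push out a
    smaller letter, which joins W. *)
Lemma rows_exchange_r (U V : seq nat) t : sorted geq U -> sorted geq V ->
  (forall z y, z \in V -> y \in U -> y < z -> y <= t) ->
  exists W Z, [/\ plactic (U ++ V) (W ++ Z), sorted geq W, sorted geq Z, all (geq t) W &
    size U <= size Z].
Proof.
elim: V U t => [|z V IH] U t sU sV h; first by exists [::], U; rewrite cats0.
move: sV; rewrite sorted_geq_cons => /andP[hV sV].
case: (row_bump' z sU) => [hU|[U1 [y [U2 [E yz h2 h1]]]]].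
  have sU' : sorted geq (rcons U z) by rewrite sorted_geq_rcons sU.
  have [|W [Z [k sW sZ hZ szW]]] := IH (rcons U z) t sU' sV.
    move=> w x wV; rewrite mem_rcons inE => /orP[/eqP ->|xU].
      by have := allP hV _ wV => /=; rewrite leqNgt => /negbTE ->.
    by apply: h xU; rewrite inE wV orbT.
  exists W, Z; rewrite -cat_rcons; split=> //; rewrite size_rcons in szW; exact: ltnW.
move: (sU); rewrite E sorted_geq_mid => /and4P[s2 _ s1 _].
have sU' : sorted geq (U2 ++ z :: U1).
  rewrite sorted_geq_mid s2 s1 h2 /=; apply: sub_all h1 => w /= wy; exact: leq_trans (ltnW yz).
have [|W [Z [k sW sZ hZ szW]]] := IH (U2 ++ z :: U1) y sU' sV.
  move=> w x /(allP hV) /= wz; rewrite mem_cat inE orbCA.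
  move=> /orP[/eqP->|/orP[/(allP h2) zx|/(allP h1) //]] xw.
    by move: wz; rewrite leqNgt xw.
  by move: xw; rewrite ltnNge (leq_trans wz zx).
exists (y :: W), Z; split=> //.
- apply: plactic_trans (_ : plactic _ ([:: y] ++ ((U2 ++ z :: U1) ++ V))) _;
    last exact: (@plactic_cat [:: y] _ [:: y] (W ++ Z)).
  rewrite -[z :: V]/([:: z] ++ V) !catA; apply: plactic_cat => //.
  rewrite -catA; apply/plactic_sym; rewrite -catA /=; apply: plactic_row => //.
  by rewrite sorted_geq_cons h1.
- by rewrite sorted_geq_cons hZ.
- rewrite /=; have tz : y <= t.
    by apply: (h z y); rewrite ?E ?mem_rcons ?mem_cat ?mem_head ?orbT.
  rewrite tz; apply: sub_all hZ => w /= wy; exact: leq_trans tz.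
- by move: szW; rewrite !size_cat.
Qed.

(** * Crystal operators and their compatibility with insertion *)

Section Crystal.

Variable i : nat.

(* Letters i are opening and letters i + 1 closing brackets. *)
Fixpoint nclose s : nat :=
  if s is x :: s' then
    if x == i then (nclose s').-1 else if x == i.+1 then (nclose s').+1 else nclose s'
  else 0.

Fixpoint nopen s : nat :=
  if s is x :: s' then if (x == i) && (nclose s' == 0) then (nopen s').+1 else nopen s'
  else 0.

(* Turns the first unmatched i into i + 1. *)
Fixpoint fop s : seq nat :=
  if s is x :: s' then if (x == i) && (nclose s' == 0) then i.+1 :: s' else x :: fop s'
  else [::].

(* Turns the last unmatched i + 1 into i, provided that there is one. *)
Fixpoint eop s : seq nat :=
  if s is x :: s' then if (x == i.+1) && (nclose s' == 0) then i :: s' else x :: eop s'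
  else [::].

Lemma nclose_cat s1 s2 : nclose (s1 ++ s2) = nclose s1 + (nclose s2 - nopen s1).
Proof. by elim: s1 => [|x s1 /= ->]; first (by rewrite subn0); do ?case: eqP => ? /=; lia. Qed.

Lemma nopen_cat s1 s2 : nopen (s1 ++ s2) = nopen s2 + (nopen s1 - nclose s2).
Proof.
elim: s1 => [|x s1 /= ->]; first by rewrite addn0.
by rewrite nclose_cat; do ?case: eqP => ? /=; lia.
Qed.

Lemma nclose_notin s : i.+1 \notin s -> nclose s = 0.
Proof.
elim: s => //= x s IH; rewrite inE negb_or => /andP[/negbTE + /IH ->].
by rewrite eq_sym => ->; case: ifP.
Qed.

Lemma nopen_notin s : i \notin s -> nopen s = 0.
Proof. by elim: s => //= x s IH; rewrite inE negb_or eq_sym => /andP[/negbTE -> /IH ->]. Qed.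

Lemma count_brackets s :
  count_mem i s + nclose s = count_mem i.+1 s + nopen s.
Proof. by elim: s => //= x s; do ?case: eqP => ? /=; lia. Qed.

Lemma fop_split s : 0 < nopen s -> exists s1 s2,
  [/\ s = s1 ++ i :: s2, fop s = s1 ++ i.+1 :: s2, nopen s1 = 0 & nclose s2 = 0].
Proof.
elim: s => //= x s IH; case: ifP => [/andP[/eqP -> /eqP q0] _|h /IH].
  by exists [::], s.
case=> s1 [s2 [E -> p1 q2]]; exists (x :: s1), s2; rewrite /= p1 -E; split=> //.
case: ifP => // /andP[/eqP ex /eqP q1]; move: h; rewrite ex eqxx E nclose_cat q1 p1 /=.
by rewrite eqxx q2.
Qed.

Lemma nclose_fop s : 0 < nopen s -> nclose (fop s) = (nclose s).+1.
Proof.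
case/fop_split => s1 [s2 [-> -> p1 q2]]; rewrite !nclose_cat /= !eqxx q2 p1 /=.
by case: eqP; lia.
Qed.

Lemma nopen_fop s : 0 < nopen s -> nopen (fop s) = (nopen s).-1.
Proof.
case/fop_split => s1 [s2 [-> -> p1 q2]]; rewrite !nopen_cat /= !eqxx q2 p1 /=.
by case: eqP => ? /=; lia.
Qed.

Lemma fopK s : 0 < nopen s -> eop (fop s) = s.
Proof.
elim: s => //= x s IH; case: ifP => [/andP[/eqP -> /eqP q0] _|h].
  by rewrite /= q0 !eqxx.
by move=> ps /=; rewrite nclose_fop // andbF IH.
Qed.

Lemma eop_sig s : 0 < nclose s ->
  [/\ nopen (eop s) = (nopen s).+1, nclose (eop s) = (nclose s).-1 & fop (eop s) = s].
Proof.
elim: s => //= x s IH; case: (eqVneq x i) => [->|xi] /=.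
  have -> : (i == i.+1) = false by case: eqP; lia.
  move=> q1; have [|p2 q2 fe] := IH; first lia.
  rewrite /= eqxx p2 q2 fe; split; do ?case: eqP => ? //=; lia.
case: (eqVneq x i.+1) => [->|xj] /=; last first.
  by move=> /IH[p2 q2 fe]; rewrite (negbTE xi) (negbTE xj) /= p2 q2 fe.
have ji : (i.+1 == i) = false by case: eqP; lia.
case: (eqVneq (nclose s) 0) => [q0 _|q0 _] /=; first by rewrite eqxx q0 /=.
have [|p2 q2 fe] := IH; first by rewrite lt0n.
by rewrite ji eqxx /= p2 q2 fe; split=> //; lia.
Qed.

Lemma nclose_col c : sorted ltn c -> nclose c = (i.+1 \in c) && (i \notin c) :> nat.
Proof.
elim: c => //= x c IH; rewrite (path_sortedE ltn_trans) => /andP[/allP hx /IH ->].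
rewrite !inE; have := hx i; have := hx i.+1; rewrite /= ![_ == x]eq_sym.
case: (i \in c); case: (i.+1 \in c); rewrite ?andbF ?andbT ?orbT ?orbF /=;
  do ?case: eqP => ? //=; lia.
Qed.

Lemma nopen_col c : sorted ltn c -> nopen c = (i \in c) && (i.+1 \notin c) :> nat.
Proof.
move=> sc; have := count_brackets c; rewrite nclose_col //.
rewrite !count_uniq_mem ?(sorted_uniq ltn_trans ltnn) //.
by case: (_ \in c); case: (_ \in c) => /=; lia.
Qed.

(** The unmatched letters form the word (i + 1)^nclose i^nopen, so these two numbers describe it. *)
Definition same_sig s s' := nclose s = nclose s' /\ nopen s = nopen s'.

Lemma same_sig_cat s1 s2 s1' s2' : same_sig s1 s1' -> same_sig s2 s2' ->
  same_sig (s1 ++ s2) (s1' ++ s2').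
Proof. by rewrite /same_sig !nclose_cat !nopen_cat => -[-> ->] [-> ->]. Qed.

(** When x replaces y between the parts c1 and c2 of the column, c1 < x <= y < c2. Both sides then
    depend only on which of i and i + 1 occur in c1 and c2 and on the values of x and y, which
    leaves finitely many cases. *)
Lemma bump_sig x c : sorted ltn c ->
  same_sig (rcons c x) (seq_of_opt (col_bump x c).2 ++ (col_bump x c).1).
Proof.
case: bumpP => [//|c1 y c2 -> h1 xy] /=; rewrite sorted_ltn_mid => /and4P[s1 h1' s2 h2].
rewrite -cats1 -[y :: c1 ++ _]cat1s -[x :: c2]cat1s -[y :: c2]cat1s /same_sig.
rewrite !(nclose_cat, nopen_cat) !(nclose_col s1, nclose_col s2, nopen_col s1, nopen_col s2).
have := allP h1 i; have := allP h1 i.+1; have := allP h2 i; have := allP h2 i.+1.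
clear h1 h1' s1 s2 h2; rewrite /=.
case: (i \in c1); case: (i.+1 \in c1); case: (i \in c2); case: (i.+1 \in c2) => /=;
  move=> H1 H2 H3 H4; (do ?case: eqP => ? /=); lia.
Qed.

Lemma reading_sig T x : valid T -> same_sig (reading (ins T x)) (rcons (reading T) x).
Proof.
elim: T x => [|c T IH] x //= /andP[/andP[_ sc] hT].
rewrite ins_cons !reading_cons rcons_cat.
have [q1 p1] := bump_sig x sc.
case: (col_bump x c).2 q1 p1 => [y|] q1 p1 /=; last first.
  by apply: same_sig_cat; split.
have [q2 p2] : same_sig (reading (ins T y) ++ (col_bump x c).1)
                        (rcons (reading T) y ++ (col_bump x c).1).
  by apply: same_sig_cat; [apply: IH | split].
have [q3 p3] : same_sig (reading T ++ (y :: (col_bump x c).1)) (reading T ++ rcons c x).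
  by apply: same_sig_cat; split.
by split; rewrite ?q2 ?p2 cat_rcons.
Qed.

Lemma reading_insw_sig T s : valid T -> same_sig (reading (insw T s)) (reading T ++ s).
Proof.
elim: s T => [|x s IH] T hT; first by rewrite cats0.
have [q1 p1] := IH _ (ins_valid x hT); rewrite /= /same_sig q1 p1 -cat_rcons.
by apply: same_sig_cat => //; apply: reading_sig.
Qed.

Lemma plactic_sig s s' : plactic s s' -> same_sig s s'.
Proof.
move=> /(_ [::] isT) E; have [q1 p1] := @reading_insw_sig [::] s isT.
by have [q2 p2] := @reading_insw_sig [::] s' isT; split; rewrite -[LHS]/(_ s);
  [rewrite -q1 E q2 | rewrite -p1 E p2].
Qed.

(* The tableaux differ by turning into i + 1 a letter i which is the first
   unmatched one in the reading word followed by s. *)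
Inductive frel : seq nat -> tableau -> tableau -> Prop :=
| frel_here s c1 c2 T of nopen (reading T ++ c1) = 0 & nclose (c2 ++ s) = 0 :
    frel s ((c1 ++ i :: c2) :: T) ((c1 ++ i.+1 :: c2) :: T)
| frel_there s c T T' of frel (c ++ s) T T' : frel s (c :: T) (c :: T').

Lemma frel_ext s s' T T' : nclose s = nclose s' -> frel s T T' -> frel s' T T'.
Proof.
move=> E H; elim: H s' E => {s T T'} [s c1 c2 T p1 q2 s' E|s c T T' _ IH s' E].
  by constructor=> //; rewrite nclose_cat -E -nclose_cat.
by constructor; apply: IH; rewrite !nclose_cat E.
Qed.

Lemma all_ltP x c : all (fun z => z < x) c -> forall y, x <= y -> y \notin c.
Proof. by move=> /allP h y xy; apply/negP => /h; rewrite ltnNge xy. Qed.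

Lemma all_gtP x c : all (ltn x) c -> forall y, y <= x -> y \notin c.
Proof. by move=> /allP h y xy; apply/negP => /h /=; rewrite ltnNge xy. Qed.

(** In the first column i and i + 1 enter the same cell unless it contains i. This column ends the
    reading word, so that i must be matched by an i + 1 in the same column; then each letter bumps
    its own copy, and the same situation recurs in the next columns. *)
Lemma ins_frel T s : valid T -> nopen (reading T) = 0 -> nclose s = 0 ->
  idx T i = idx T i.+1 /\ frel s (ins T i) (ins T i.+1).
Proof.
elim: T s => [|c T IH] s.
  by move=> _ _ q0; split=> //; apply: (@frel_here s [::] [::] [::]).
move=> /= /andP[/andP[_ sc] hT]; rewrite reading_cons => p0 q0.
rewrite !ins_cons !idx_cons; have jE : (i.+1 == i) = false by case: eqP; lia.
case: (bumpP i c) => [h|c1 y c2 E h iy].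
  have h' : all (fun z => z < i.+1) c by apply: sub_all h => z /ltnW.
  rewrite -[c]cats0 bump_skip //= cats0 -cats1; split=> //.
  exact: frel_here.
have h' : all (fun z => z < i.+1) c1 by apply: sub_all h => z /ltnW.
move: sc p0; rewrite {c}E sorted_ltn_mid => /and4P[s1 h1 s2 h2] p0.
have Nc1 := all_ltP h; have Nc2 := all_gtP h2.
have [pc1 qc1] : nopen c1 = 0 /\ nclose c1 = 0.
  by rewrite nopen_notin ?nclose_notin ?Nc1.
case: (ltngtP i.+1 y) => iy1.
- rewrite (@bump_hit i.+1 y) ?(ltnW iy1) //=; split=> //; constructor; last first.
    by rewrite nclose_cat q0 nclose_notin // Nc2 // ltnW.
  have yi : (y == i) = false by case: eqP => //; lia.
  have yj : (y == i.+1) = false by case: eqP => //; lia.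
  have q2 : nclose c2 = 0 by rewrite nclose_notin // Nc2 // ltnW.
  have [_ pE] := reading_sig y hT.
  move: p0; rewrite !(nopen_cat, nclose_cat) pE -cats1 !(nopen_cat, nclose_cat) /= yi yj q2 pc1 qc1 /=; lia.
- have ey : y = i by lia.
  rewrite {y iy iy1 h1}ey in h2 p0 Nc2 *.
  have jc2 : i.+1 \in c2.
    apply/negPn/negP => nj; move: p0.
    by rewrite catA nopen_cat /= [nclose c2]nclose_notin // eqxx.
  case: c2 s2 h2 p0 Nc2 jc2 => [//|z c2] s2 h2 p0 Nc2.
  rewrite inE => jz; have {jz} ez : z = i.+1.
    case/orP: jz => [/eqP -> //|jc2]; move: s2; rewrite /= (path_sortedE ltn_trans).
    case/andP => /allP /(_ _ jc2) /= zi _; move: h2; rewrite /= => /andP[iz _]; lia.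
  rewrite {z}ez in s2 h2 p0 Nc2 *.
  have -> : col_bump i.+1 (c1 ++ i :: i.+1 :: c2) = (c1 ++ i :: i.+1 :: c2, Some i.+1).
    by rewrite -cat_rcons bump_hit ?all_rcons ?ltnSn.
  have Q : nclose (c1 ++ i :: i.+1 :: c2) = 0 /\ nopen (c1 ++ i :: i.+1 :: c2) = 0.
    have sc : sorted ltn (c1 ++ i :: i.+1 :: c2) by rewrite sorted_ltn_mid s1 h s2 h2.
    by rewrite nclose_col // nopen_col // !mem_cat !inE !eqxx !orbT.
  have [||ei fr] := IH ((c1 ++ i :: i.+1 :: c2) ++ s) hT.
  - by move: p0; rewrite nopen_cat; lia.
  - by rewrite nclose_cat; lia.
  by rewrite /= ei; split=> //; constructor.
- rewrite -{y}iy1 in h2 p0 Nc2 h1 iy *.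
  rewrite bump_hit //=; split=> //.
  have jc2 : nclose c2 = 0 by rewrite nclose_notin // Nc2.
  constructor; last by rewrite nclose_cat jc2 q0.
  have [_ pE] := reading_sig i.+1 hT.
  move: p0; rewrite !(nopen_cat, nclose_cat) pE -cats1 !(nopen_cat, nclose_cat) /= jE eqxx jc2 /=.
  rewrite -[nopen c2]/(nopen c2) pc1 qc1; lia.
Qed.

(** A letter at most i that reaches the differing cell ejects i from one tableau and i + 1 from the
    other, as in [ins_frel]; other letters act alike on both. The letter i + 1 is excluded there
    because it would close the unmatched i. The word s0 represents x :: s only up to [nclose], since
    in the next column another letter and another word take their places. *)
Lemma frel_ins_ext s0 s x T T' : frel s0 T T' -> nclose s0 = nclose (x :: s) ->
  valid T -> valid T' -> idx T x = idx T' x /\ frel s (ins T x) (ins T' x).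
Proof.
move=> H; elim: H x s => {s0 T T'} [s0 c1 c2 T p0 q0|s0 c T T' H IH] x s Es.
  have {s0 Es}q0 : nclose (c2 ++ x :: s) = 0 by rewrite nclose_cat -Es -nclose_cat.
  move=> /= /andP[/andP[_ sc] hT] /andP[/andP[_ sc'] _].
  rewrite !ins_cons !idx_cons.
  move: sc; rewrite sorted_ltn_mid => /and4P[s1 h1 s2 h2].
  move: sc'; rewrite sorted_ltn_mid => /and4P[_ _ _ h2'].
  have Nc1 := all_ltP h1; have Nc2 := all_gtP h2'.
  have [pc1 qc1] : nopen c1 = 0 /\ nclose c1 = 0.
    by rewrite nopen_notin ?nclose_notin ?Nc1.
  have [pc2 qc2] : nopen c2 = 0 /\ nclose c2 = 0.
    by rewrite nopen_notin ?nclose_notin ?Nc2.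
  have pT : nopen (reading T) = 0 by move: p0; rewrite nopen_cat; lia.
  case: (boolP (all (fun z => z < x) c1)) => hx; last first.
    rewrite !bump_prefix //=; move: hx; case: bumpP => [->//|c3 y c4 E h3 xy _] /=.
    split=> //; have yi : y < i by apply: (allP h1); rewrite E mem_cat mem_head orbT.
    constructor.
      have [_ pE] := reading_sig y hT.
      rewrite nopen_cat pE -cats1 [nopen (reading T ++ _)]nopen_cat pT.
      rewrite [nopen [:: y]]nopen_notin; last by rewrite inE; lia.
      rewrite nopen_notin ?addn0 //; apply/negP; rewrite mem_cat inE.
      move=> /or3P[i3|/eqP i3|i4]; last 2 first.
      + by move: yi; rewrite i3; lia.
      + by have := Nc1 i (leqnn _); rewrite E mem_cat inE i4 !orbT.
      by have := Nc1 i (leqnn _); rewrite E mem_cat i3.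
    move: q0; rewrite !nclose_cat pc2 qc2 /=; do 2?case: eqP => //; lia.
  rewrite !bump_skip //; case: (ltngtP x i.+1) => xi.
  - rewrite !(@bump_hd_ge _ x) ?(ltnW xi) //=.
    have [|ei fr] := @ins_frel T ((c1 ++ x :: c2) ++ s) hT pT.
      move: q0; rewrite -[x :: c2]cat1s -[x :: s]cat1s -!catA !nclose_cat; lia.
    by rewrite ei; split=> //; constructor.
  - rewrite !(@bump_hd_lt _ x) ?(ltnW xi) //=.
    have oE : forall y, (col_bump x c2).2 = Some y -> i < y /\ i.+1 < y.
      move=> y E; have := bump_out_mem x c2; rewrite E => yc2.
      by have := allP h2' y yc2 => /=; lia.
    have dE : i.+1 \notin (col_bump x c2).1.
      by apply: all_gtP (bump_all_gt h2' xi) _ _.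
    case: (col_bump x c2).2 oE => [y|] oE; split=> //; constructor.
    + have [i1 i2] := oE y erefl; have [_ pE] := reading_sig y hT.
      rewrite nopen_cat pE -cats1 [nopen (reading T ++ _)]nopen_cat pT.
      rewrite [nopen [:: y]]nopen_notin; last by rewrite inE; lia.
      by rewrite pc1.
    + by move: q0; rewrite !nclose_cat [nclose (col_bump x c2).1]nclose_notin //= ; do 2?case: eqP => //; lia.
    + by rewrite nopen_cat pT pc1.
    + by move: q0; rewrite !nclose_cat [nclose (col_bump x c2).1]nclose_notin //= ; do 2?case: eqP => //; lia.
  - by move: q0; rewrite xi nclose_cat /= eqxx pc2; case: eqP; lia.
move=> /= /andP[/andP[_ sc] hT] /andP[_ hT'].
rewrite !ins_cons !idx_cons.
have [q1 p1] := bump_sig x sc.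
have E : nclose (c ++ x :: s) =
    nclose (seq_of_opt (col_bump x c).2 ++ (col_bump x c).1 ++ s).
  by rewrite -cat_rcons catA !(nclose_cat _ s) q1 p1.
have {}E : nclose (c ++ s0) =
    nclose (seq_of_opt (col_bump x c).2 ++ (col_bump x c).1 ++ s).
  by rewrite -E !nclose_cat Es.
case: (col_bump x c).2 E => [y|] E; last by split=> //; constructor; apply: frel_ext H.
by have [-> fr] := IH y ((col_bump x c).1 ++ s) E hT hT'; split=> //; constructor.
Qed.

Lemma frel_cols s T T' : valid T -> valid T' -> frel s T T' -> cols T s = cols T' s.
Proof.
elim: s T T' => //= x s IH T T' vT vT' H.
have [-> fr] := frel_ins_ext H erefl vT vT'.
by rewrite (IH _ _ (ins_valid x vT) (ins_valid x vT') fr).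
Qed.

(** Invariance of the recording tableau: the changed letter creates two tableaux related by [frel],
    which then grow in the same columns. *)
Lemma cols_fop s : 0 < nopen s -> cols [::] (fop s) = cols [::] s.
Proof.
case/fop_split=> s1 [s2 [-> -> p1 q2]]; rewrite !cols_cat /=; congr cat.
have v1 : valid (insw [::] s1) by apply: insw_valid.
have [_ p0] := @reading_insw_sig [::] s1 isT.
have [|-> fr] := ins_frel v1 _ q2; first by rewrite p0.
by congr cons; apply/esym/frel_cols; rewrite ?ins_valid.
Qed.

End Crystal.

(** * Two consecutive blocks of a key recording *)

Lemma sorted_ltn_iota_eq s m : sorted ltn s -> s =i iota 0 m -> s = iota 0 m.
Proof. move=> ss; exact: irr_sorted_eq ltn_trans ltnn _ _ ss (iota_ltn_sorted _ _). Qed.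

(** As p <= q, all entries are less than q; a strictly increasing s with at least q of them contains
    them all. *)
Lemma perm_iota_cat s s' p q : sorted ltn s -> sorted ltn s' ->
  perm_eq (s ++ s') (iota 0 p ++ iota 0 q) -> p <= q -> q <= size s ->
  s = iota 0 q /\ s' = iota 0 p.
Proof.
move=> ss ss' E pq szs.
have sub : {subset s <= iota 0 q}.
  move=> x xs; have := perm_mem E x; rewrite !mem_cat xs /= !mem_iota !add0n => /esym.
  by case/orP=> // xp; apply: leq_trans pq.
have us := sorted_uniq ltn_trans ltnn ss.
have Es : s = iota 0 q.
  apply: sorted_ltn_iota_eq => //.
  by have [] := uniq_min_size us sub _; rewrite ?size_iota.
split=> //; apply: sorted_ltn_iota_eq => //; apply: perm_mem.
by move: E; rewrite Es perm_sym perm_catC perm_cat2l perm_sym.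
Qed.

Section TwoRows.

Variables (T : tableau) (U V : seq nat) (p q : nat).
Hypotheses (vT : valid T) (cU : cols T U = iota 0 p) (cV : cols (insw T U) V = iota 0 q).

Lemma rows_sorted : sorted geq U /\ sorted geq V.
Proof.
by split; [rewrite -(cols_row _ vT) cU | rewrite -(cols_row _ (insw_valid U vT)) cV];
  apply: iota_ltn_sorted.
Qed.

Lemma plactic_cols_perm (W Z : seq nat) : plactic (U ++ V) (W ++ Z) ->
  perm_eq (cols T W ++ cols (insw T W) Z) (iota 0 p ++ iota 0 q).
Proof. by move=> /(_ T vT) /cols_perm; rewrite !cols_cat cU cV perm_sym. Qed.

(** By [perm_iota_cat] the exchanged row W has exactly q letters, as V has: this is the case of
    equality in [rows_exchange_l]. *)
Lemma rows_dominated : p <= q -> forall y, y \in U -> has (ltn y) V.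
Proof.
move=> pq; have [sU sV] := rows_sorted.
have [//|W [Z [pl sW sZ _ [szW]]]] := @rows_exchange_l U V 0 sU sV.
apply; apply/eqP; rewrite eqn_leq szW -(size_cols T W) /=.
have szV : size V = q by rewrite -(size_cols (insw T U)) cV size_iota.
have sW' : sorted ltn (cols T W) by rewrite cols_row.
have sZ' : sorted ltn (cols (insw T W) Z) by rewrite cols_row ?insw_valid.
have [|-> _] := perm_iota_cat sW' sZ' (plactic_cols_perm pl) pq.
  by rewrite size_cols -szV.
by rewrite size_iota szV.
Qed.

(** The column indices of W and of Z increase strictly and together form the old multiset. A lower
    bound on the length of the longer row, which is W if p <= q and Z otherwise, thus determines
    them by [perm_iota_cat]. *)
Lemma swap_rows : exists W Z, [/\ plactic (U ++ V) (W ++ Z),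
  cols T W = iota 0 q & cols (insw T W) Z = iota 0 p].
Proof.
have [sU sV] := rows_sorted.
have szU : size U = p by rewrite -(size_cols T) cU size_iota.
have szV : size V = q by rewrite -(size_cols (insw T U)) cV size_iota.
case: (leqP p q) => pq.
  have [//|W [Z [pl sW sZ _ [szW _]]]] := @rows_exchange_l U V 0 sU sV.
  have sW' : sorted ltn (cols T W) by rewrite cols_row.
  have sZ' : sorted ltn (cols (insw T W) Z) by rewrite cols_row ?insw_valid.
  have [|E1 E2] := perm_iota_cat sW' sZ' (plactic_cols_perm pl) pq.
    by rewrite size_cols -szV.
  by exists W, Z.
(* The maximum of U is a bound t that holds trivially. *)
have [|W [Z [pl sW sZ _ szZ]]] := @rows_exchange_r U V (\max_(x <- U) x) sU sV.
  by move=> z y _ yU _; exact: (@leq_bigmax_seq _ U xpredT id y yU).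
have sW' : sorted ltn (cols T W) by rewrite cols_row.
have sZ' : sorted ltn (cols (insw T W) Z) by rewrite cols_row ?insw_valid.
have E := plactic_cols_perm pl; rewrite perm_catC perm_sym perm_catC perm_sym in E.
have [||E1 E2] := perm_iota_cat sZ' sW' E; first exact: ltnW.
  by rewrite size_cols -szU.
by exists W, Z.
Qed.

End TwoRows.

(** * Flagged words with a key as recording tableau *)

(* The columns of the successive new cells when the recording tableau is
   std (key b). *)
Definition key_cols (b : seq nat) : seq nat := flatten [seq iota 0 m | m <- b].

(* The position in b, counted from k, of the block of each letter. *)
Fixpoint row_index (k : nat) (b : seq nat) : seq nat :=
  if b is m :: b' then nseq m k ++ row_index k.+1 b' else [::].

(** Membership in W(b). By [cols_row] the column indices also encode that each block is weakly
    decreasing. *)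
Definition flagged_key b s : bool :=
  (cols [::] s == key_cols b) && all2 leq s (row_index 0 b).

Lemma size_key_cols b : size (key_cols b) = sumn b.
Proof. by rewrite size_flatten /shape -map_comp (eq_map (size_iota 0)) map_id. Qed.

Lemma key_cols_cat b1 b2 : key_cols (b1 ++ b2) = key_cols b1 ++ key_cols b2.
Proof. by rewrite /key_cols map_cat flatten_cat. Qed.

Lemma row_index_cat k b1 b2 :
  row_index k (b1 ++ b2) = row_index k b1 ++ row_index (k + size b1) b2.
Proof.
by elim: b1 k => [|m b1 IH] k /=; rewrite ?addn0 // IH addSnnS catA.
Qed.

Lemma size_row_index k b : size (row_index k b) = sumn b.
Proof. by elim: b k => //= m b IH k; rewrite size_cat size_nseq IH. Qed.

Lemma row_index_bounds k b : all (fun x => k <= x < k + size b) (row_index k b).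
Proof.
elim: b k => //= m b IH k; rewrite all_cat all_nseq leqnn /= addnS ltnS leq_addr orbT /=.
by apply: sub_all (IH k.+1) => x /andP[/ltnW -> +]; rewrite addSn.
Qed.

Lemma row_index_sorted k b : sorted leq (row_index k b).
Proof.
elim: b k => //= m b IH k; rewrite (sorted_pairwise leq_trans) pairwise_cat.
rewrite -!(sorted_pairwise leq_trans) IH andbT; apply/andP; split.
  by apply/allrelP => x y /nseqP[-> _] /(allP (row_index_bounds k.+1 b)) /andP[/ltnW].
by elim: m => //= -[|m] //= ->; rewrite leqnn.
Qed.

Lemma all2_nseq (r : rel nat) s k m :
  all2 r s (nseq m k) = (size s == m) && all (r^~ k) s.
Proof. by elim: s m => [|x s IH] [|m] //=; rewrite IH eqSS andbCA. Qed.

Lemma all2_cat (r : rel nat) s1 s2 t1 t2 : size s1 = size t1 ->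
  all2 r (s1 ++ s2) (t1 ++ t2) = all2 r s1 t1 && all2 r s2 t2.
Proof. by elim: s1 t1 => [|x s1 IH] [|y t1] //= [/IH ->]; rewrite andbA. Qed.

Lemma all2_leq_bound s t k : all2 leq s t -> all (fun x => x < k) t -> all (fun x => x < k) s.
Proof.
elim: s t => [|x s IH] [|y t] //= /andP[xy /IH h] /andP[yk /h ->].
by rewrite (leq_ltn_trans xy).
Qed.

Lemma flagged_key_size b s : flagged_key b s -> size s = sumn b.
Proof. by case/andP=> _; rewrite all2E size_row_index => /andP[/eqP]. Qed.

Lemma flagged_key_lt b s : flagged_key b s -> all (fun x => x < size b) s.
Proof.
case/andP=> _ /all2_leq_bound; apply.
by apply: sub_all (row_index_bounds 0 b) => x /andP[].
Qed.

Lemma flagged_key_inj b s s' : flagged_key b s -> flagged_key b s' ->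
  insw [::] s = insw [::] s' -> s = s'.
Proof. by case/andP=> /eqP c1 _ /andP[/eqP c2 _] /insw_inj; apply; rewrite c1 c2. Qed.

Lemma key_cols_blocks b1 p q b2 s : cols [::] s = key_cols (b1 ++ p :: q :: b2) ->
  exists S0 U V S3 : seq nat, s = S0 ++ U ++ V ++ S3 /\ [/\ cols [::] S0 = key_cols b1,
    cols (insw [::] S0) U = iota 0 p, cols (insw (insw [::] S0) U) V = iota 0 q &
    cols (insw (insw [::] S0) (U ++ V)) S3 = key_cols b2].
Proof.
rewrite -[p :: q :: b2]/([:: p] ++ [:: q] ++ b2) !key_cols_cat.
rewrite -![key_cols [:: _]]/(iota 0 _ ++ [::]) !cats0 => C.
have split_at t l1 l2 T : cols T t = l1 ++ l2 -> exists t1 t2,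
    [/\ t = t1 ++ t2, cols T t1 = l1 & cols (insw T t1) t2 = l2].
  move=> E; exists (take (size l1) t), (drop (size l1) t); rewrite cat_take_drop.
  have sz : size (cols T (take (size l1) t)) = size l1.
    by rewrite size_cols size_takel // -(size_cols T t) E size_cat leq_addr.
  by move: E; rewrite -{1}(cat_take_drop (size l1) t) cols_cat => /eqP;
    rewrite eqseq_cat // => /andP[/eqP -> /eqP ->].
have [S0 [t [Es C0 Ct]]] := split_at _ _ _ _ C.
have [U [t' [Et CU Ct']]] := split_at _ _ _ _ Ct.
have [V [S3 [Et' CV CS3]]] := split_at _ _ _ _ Ct'.
by exists S0, U, V, S3; rewrite Es Et Et'; split=> //; split=> //; rewrite insw_cat.
Qed.

Lemma blocks_key_cols b1 p q b2 (S0 U V S3 : seq nat) : cols [::] S0 = key_cols b1 ->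
    cols (insw [::] S0) U = iota 0 p -> cols (insw (insw [::] S0) U) V = iota 0 q ->
    cols (insw (insw [::] S0) (U ++ V)) S3 = key_cols b2 ->
  cols [::] (S0 ++ U ++ V ++ S3) = key_cols (b1 ++ p :: q :: b2).
Proof.
by move=> C0 CU CV CS3; rewrite !cols_cat C0 CU CV -insw_cat CS3 key_cols_cat /key_cols.
Qed.

Lemma all2_blocks (r : rel nat) b1 p q b2 (S0 U V S3 : seq nat) T1 T2 T3 :
    cols T1 S0 = key_cols b1 -> cols T2 U = iota 0 p -> cols T3 V = iota 0 q ->
  all2 r (S0 ++ U ++ V ++ S3) (row_index 0 (b1 ++ p :: q :: b2)) =
  [&& all2 r S0 (row_index 0 b1), all (r^~ (size b1)) U, all (r^~ (size b1).+1) V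
    & all2 r S3 (row_index (size b1).+2 b2)].
Proof.
move=> C0 CU CV.
have z0 : size S0 = sumn b1 by rewrite -size_key_cols -C0 size_cols.
have zU : size U = p by rewrite -(size_iota 0 p) -CU size_cols.
have zV : size V = q by rewrite -(size_iota 0 q) -CV size_cols.
rewrite row_index_cat /= add0n !all2_cat ?size_row_index ?size_nseq //.
by rewrite !all2_nseq zU zV !eqxx.
Qed.

Lemma eop_flags i s F : all2 leq s F -> all2 leq (eop i s) F.
Proof.
elim: s F => [|x s IH] [|k F] //= /andP[xk sF].
case: ifP => [/andP[/eqP ex _]|_] /=; last by rewrite xk IH.
by rewrite sF andbT; apply: leq_trans xk; rewrite ex.
Qed.

Lemma fop_flags_le i s F : all2 leq s F -> all (ltn i) F -> all2 leq (fop i s) F.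
Proof.
elim: s F => [|x s IH] [|k F] //= /andP[xk sF] /andP[ik iF].
by case: ifP => _ /=; [rewrite sF andbT | rewrite xk IH].
Qed.

(** Some i + 1 precedes the changed letter. Its flag is at least i + 1, and the flags increase, so
    the changed letter is allowed to become i + 1. *)
Lemma fop_flags i s F : all2 leq s F -> sorted leq F -> 0 < nclose i s ->
  all2 leq (fop i s) F.
Proof.
elim: s F => [|x s IH] [|k F] //= /andP[xk sF].
rewrite (path_sortedE leq_trans) => /andP[kF srtF].
case: (eqVneq x i) => [ex|xi] /=.
  case: (eqVneq (nclose i s) 0) => [->//|q0 q1] /=.
  by rewrite xk IH // lt0n.
case: (eqVneq x i.+1) => [ex _|_ q0]; rewrite xk /=; last exact: IH.
apply: fop_flags_le => //; apply: sub_all kF => z /=; rewrite ex in xk; exact: leq_trans.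
Qed.

Lemma flagged_key_eop b i s : 0 < nclose i s -> flagged_key b s -> flagged_key b (eop i s).
Proof.
move=> qs /andP[C F]; apply/andP; split; last exact: eop_flags.
by have [pe _ fe] := eop_sig qs; rewrite -(@cols_fop i) ?pe // fe.
Qed.

Lemma flagged_key_fop b i s : 0 < nclose i s -> 0 < nopen i s -> flagged_key b s ->
  flagged_key b (fop i s).
Proof.
move=> qs ps /andP[C F]; apply/andP; split; first by rewrite cols_fop.
by apply: fop_flags => //; apply: row_index_sorted.
Qed.

(** The flag condition, relaxed in the only way in which [fop] can break it. *)
Definition leq_or_succ i (x k : nat) := (x <= k) || (k == i) && (x == i.+1).

Lemma fop_weak_flags i s F : all2 leq s F -> all2 (leq_or_succ i) (fop i s) F.
Proof.
elim: s F => [|x s IH] [|k F] //= /andP[xk sF].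
have weak t G : all2 leq t G -> all2 (leq_or_succ i) t G.
  by elim: t G => [|y t IHt] [|l G] //= /andP[h /IHt ->]; rewrite /leq_or_succ h.
case: ifP => [/andP[/eqP ex _]|_] /=; last by rewrite IH // /leq_or_succ xk.
by rewrite weak // andbT /leq_or_succ eqxx andbT; rewrite ex in xk; case: ltngtP xk.
Qed.

Lemma weak_flags i s F : i \notin F -> all2 (leq_or_succ i) s F = all2 leq s F.
Proof.
elim: s F => [|x s IH] [|k F] //=; rewrite inE negb_or => /andP[ik /IH ->].
by rewrite /leq_or_succ [k == i]eq_sym (negbTE ik) orbF.
Qed.

(* Only the block of index i could get a letter that is too large, but such an
   i + 1 would not be dominated by the next block. *)
Lemma flagged_key_fop_ascent b1 p q b2 s : p <= q -> 0 < nopen (size b1) s ->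
  flagged_key (b1 ++ p :: q :: b2) s -> flagged_key (b1 ++ p :: q :: b2) (fop (size b1) s).
Proof.
move=> pq ps /andP[C /(fop_weak_flags (size b1)) F].
have C' : cols [::] (fop (size b1) s) = key_cols (b1 ++ p :: q :: b2).
  by rewrite cols_fop //; apply/eqP.
rewrite /flagged_key C' eqxx /=.
have [S0 [U [V [S3 [E [C0 CU CV _]]]]]] := key_cols_blocks C'.
move: F; rewrite E !(all2_blocks _ _ _ C0 CU CV) => /and4P[F0 FU FV F3].
move: F0 F3; rewrite !weak_flags; last 2 first.
- by apply/negP => /(allP (row_index_bounds _ _)); rewrite ltnNge leqnSn.
- by apply/negP => /(allP (row_index_bounds _ _)); rewrite add0n ltnn andbF.
move=> -> ->; rewrite andbT /=.
have FV' : all (geq (size b1).+1) V.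
  by apply: sub_all FV => x /=; rewrite /leq_or_succ gtn_eqF // orbF.
rewrite FV' andbT; apply/allP => y yU.
have := allP FU y yU; rewrite /leq_or_succ eqxx => /orP[//|/eqP ey].
have /hasP[z zV] := rows_dominated (@insw_valid [::] S0 isT) CU CV pq yU.
by have /= := allP FV' z zV; rewrite ey ltnNge => ->.
Qed.

(* The letters of the exchanged rows are controlled by the brackets: as no
   bracket i + 1 is unmatched, the new block of index i contains none. *)
Lemma flagged_key_swap b1 p q b2 s : nclose (size b1) s = 0 ->
    flagged_key (b1 ++ p :: q :: b2) s ->
  exists s', [/\ flagged_key (b1 ++ q :: p :: b2) s', nclose (size b1) s' = 0 &
    insw [::] s' = insw [::] s].
Proof.
set i := size b1; move=> q0 /andP[/eqP C F].
have [S0 [U [V [S3 [E [C0 CU CV C3]]]]]] := key_cols_blocks C.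
move: F; rewrite E (all2_blocks _ _ _ C0 CU CV) -/i => /and4P[F0 FU FV F3].
have vT := @insw_valid [::] S0 isT.
have [W [Z [pl CW CZ]]] := swap_rows vT CU CV.
have pl' : plactic s (S0 ++ W ++ Z ++ S3).
  by rewrite E; apply: plactic_cat => //; rewrite !catA; apply: plactic_cat.
have q0' : nclose i (S0 ++ W ++ Z ++ S3) = 0.
  by have [<- _] := plactic_sig i pl'.
exists (S0 ++ W ++ Z ++ S3); split=> //; last by rewrite -E -(pl' [::] isT).
have FWZ : all (geq i.+1) (W ++ Z).
  rewrite -(perm_all _ (plactic_perm pl)) all_cat FV andbT.
  by apply: sub_all FU => x /= /leqW.
have C' : cols [::] (S0 ++ W ++ Z ++ S3) = key_cols (b1 ++ q :: p :: b2).
  by apply: blocks_key_cols; rewrite // -(pl _ vT).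
rewrite /flagged_key C' eqxx /=.
rewrite (all2_blocks _ _ _ C0 CW CZ) F0 F3 -/i andbT /=.
move: FWZ; rewrite all_cat => /andP[FW ->]; rewrite andbT.
have sW : sorted geq W by rewrite -(cols_row _ vT) CW iota_ltn_sorted.
(* The letters before W are smaller than i, so no bracket there can match an i + 1 of W. *)
have pS0 : nopen i S0 = 0.
  have h : all (fun x => x < i) S0.
    by apply: all2_leq_bound F0 _; apply: sub_all (row_index_bounds 0 b1) => x /andP[].
  exact/nopen_notin/(all_ltP h).
have {q0' pS0}qW : nclose i W = 0.
  by move: q0'; rewrite !nclose_cat pS0 subn0; lia.
case: W sW FW qW {pl pl' CW CZ C'} => //= x W xW /andP[xi _] qW.
(* The first letter of W is its largest; were it i + 1, it would be unmatched in W. *)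
have {qW}xi' : x <= i by move: xi qW; case: ltngtP => //= ->; rewrite gtn_eqF // eqxx.
rewrite xi' /=; apply: sub_all (_ : all (geq x) W) => [y /= yx|]; first exact: leq_trans xi'.
by move: xW; rewrite -/(sorted geq (x :: W)) sorted_geq_cons => /andP[].
Qed.

(** * The case of weakly decreasing parts *)

Lemma bump_mem x c : sorted ltn c -> x \in c -> col_bump x c = (c, Some x).
Proof.
move=> sc xc; move: sc; case/splitPr: xc => c1 c2.
by rewrite sorted_ltn_mid => /and4P[_ h _ _]; rewrite bump_hit.
Qed.

Lemma idx_ge_mem T x m : valid T -> (forall k, k < m -> x \in nth [::] T k) ->
  m <= idx T x.
Proof.
elim: T m => [|c T IH] [|m] //=; first by move=> _ /(_ 0 isT).
case/andP=> /andP[_ sc] vT h; rewrite idx_cons bump_mem ?(h 0) //=.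
by rewrite ltnS IH // => k km; apply: (h k.+1).
Qed.

Lemma ins_row_end T x m : valid T -> (forall k, k < m -> x \in nth [::] T k) ->
    all (fun z => z < x) (nth [::] T m) ->
  idx T x = m /\ forall k, nth [::] (ins T x) k =
    if k == m then rcons (nth [::] T m) x else nth [::] T k.
Proof.
elim: T m => [|c T IH] [|m] /=.
- by move=> _ _ _; split=> // -[|[|k]] /=.
- by move=> _ /(_ 0 isT).
- move=> _ _ h; rewrite idx_cons ins_cons -[c]cats0 bump_skip //= cats0 cats1.
  by split=> // -[|k] /=.
case/andP=> /andP[_ sc] vT h hm; rewrite idx_cons ins_cons bump_mem ?(h 0) //=.
have [|-> E] := IH m vT _ hm; first by move=> k km; apply: (h k.+1).
by split=> // -[|k] //=; rewrite E eqSS.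
Qed.

(** For weakly decreasing b, this describes the tableau whose row v consists of b_v letters v. *)
Definition superstandard T (b : seq nat) :=
  forall k v, (v \in nth [::] T k) = (k < nth 0 b v).

Lemma superstandard_rcons0 T b : superstandard T b -> superstandard T (rcons b 0).
Proof.
move=> h k v; rewrite h nth_rcons; case: (ltnP v (size b)) => // bv; rewrite nth_default //.
by case: ifP.
Qed.

(** A letter bumps its own copy out of each column that contains it. A letter x below [size b]
    occurs in the columns 0, ..., j and therefore ends beyond column j, whereas [size b] itself
    stops there. *)
Lemma superstandard_ins T b j x : valid T -> superstandard T (rcons b j) ->
    all (fun z => j < z) b -> x <= size b ->
  (idx T x == j) = (x == size b) /\
  superstandard (ins T (size b)) (rcons b j.+1).
Proof.
move=> vT st hb xb.
have [|| E1 E2] := @ins_row_end T (size b) j vT.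
- by move=> k kj; rewrite st nth_rcons ltnn eqxx.
- apply/allP=> z; rewrite st nth_rcons; case: (ltnP z (size b)) => // bz.
  by case: eqP => // _; rewrite ltnn.
split.
  case: (ltngtP x (size b)) xb => [xb _|//|-> _]; last by rewrite E1 eqxx.
  apply/negbTE; rewrite neq_ltn orbC; apply/orP; left.
  apply: (@idx_ge_mem T x j.+1 vT) => k kj; rewrite st nth_rcons xb.
  by have := allP hb _ (mem_nth 0 xb) => jb; apply: leq_trans jb.
move=> k v; rewrite E2 !nth_rcons; case: (eqVneq k j) => [->|kj].
  rewrite mem_rcons inE st nth_rcons; case: (ltngtP v (size b)) => vb //=.
  by rewrite ltnSn.
rewrite st nth_rcons; case: (ltnP v (size b)) => // _; case: eqP => // _; rewrite ltnS.
by rewrite [k <= j]leq_eqVlt (negbTE kj).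
Qed.

(** Each letter of the block must be the largest one allowed, as by [superstandard_ins] a smaller
    one would land too far to the right. *)
Lemma superstandard_row T b j m : valid T -> superstandard T (rcons b j) ->
    all (fun z => j + m <= z) b ->
  [/\ cols T (nseq m (size b)) = iota j m,
      superstandard (insw T (nseq m (size b))) (rcons b (j + m)) &
      forall s, cols T s = iota j m -> all (geq (size b)) s -> s = nseq m (size b)].
Proof.
elim: m T j => [|m IH] T j vT st hb.
  by rewrite addn0; split=> // -[|].
have hb' : all (fun z => j < z) b.
  by apply: sub_all hb => z; apply: leq_trans; rewrite addnS ltnS leq_addr.
have [E st'] := superstandard_ins vT st hb' (leqnn _).
have {E}E : idx T (size b) = j by apply/eqP; rewrite E.
have [|E1 E2 E3] := IH (ins T (size b)) j.+1 (ins_valid _ vT) st'.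
  by rewrite addSnnS.
rewrite addnS -addSn; split=> //=; first by rewrite E E1.
move=> [|x s] //= [Ex Es] /andP[xb hs].
have [] := superstandard_ins vT st hb' xb; rewrite Ex eqxx => /esym/eqP ex _.
by rewrite -ex in E3 hs *; rewrite (E3 s).
Qed.

Lemma superstandard_words T b1 b2 : valid T -> superstandard T b1 -> sorted geq (b1 ++ b2) ->
  cols T (row_index (size b1) b2) = key_cols b2 /\
  forall s, cols T s = key_cols b2 -> all2 leq s (row_index (size b1) b2) ->
  s = row_index (size b1) b2.
Proof.
elim: b2 b1 T => [|m b2 IH] b1 T vT st sb; first by split=> // -[|].
have [||E1 E2 E3] := @superstandard_row T b1 0 m vT.
- exact: superstandard_rcons0.
- by move: sb; rewrite sorted_geq_mid => /and4P[].
have [|F1 F2] := IH (rcons b1 m) _ (insw_valid (nseq m (size b1)) vT) E2.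
  by rewrite cat_rcons.
rewrite size_rcons in F1 F2; rewrite /= cols_cat E1 F1; split=> // s.
move=> C; rewrite -(cat_take_drop m s).
have sz : size (take m s) = m.
  by rewrite size_takel // -(size_cols T s) C size_cat size_iota leq_addr.
rewrite all2_cat ?size_nseq // all2_nseq => /andP[/andP[_ h1] h2].
move: C; rewrite -{1}(cat_take_drop m s) cols_cat => /eqP.
rewrite eqseq_cat ?size_cols ?sz ?size_iota // => /andP[/eqP C1 /eqP C2].
have e1 := E3 _ C1 h1; rewrite e1 in C2 *.
by rewrite (F2 _ C2 h2).
Qed.

Lemma flagged_key_decreasing b s : sorted geq b ->
  flagged_key b s = (s == row_index 0 b).
Proof.
move=> sb; have [|C U] := @superstandard_words [::] [::] b isT _ sb.
  by move=> k v; rewrite !nth_nil.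
apply/andP/eqP => [[/eqP h1 h2]|->]; first exact: U.
rewrite C; split=> //; elim: (row_index 0 b) => //= x t ->.
by rewrite leqnn.
Qed.

(** * Recording tableaux and standardized keys *)

(* The recording tableau, from the list of the columns of the new cells, most
   recent first. *)
Fixpoint recording (l : seq nat) : tableau :=
  if l is k :: l' then
    set_nth [::] (recording l') k (rcons (nth [::] (recording l') k) (size l'))
  else [::].

Lemma col_RS_rev s : col_RS (rev s) = (insw [::] s, recording (rev (cols [::] s))).
Proof.
elim/last_ind: s => // s x IH; rewrite rev_rcons /= IH -cats1 insw_cat cols_cat.
rewrite cats1 rev_rcons /= !size_rev size_cols /ins /idx.
by case: (col_insert x _).
Qed.

Lemma nth_recording l k : nth [::] (recording (rev l)) k =
  [seq m <- iota 0 (size l) | nth 0 l m == k].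
Proof.
elim/last_ind: l k => [|l x IH] k; first by rewrite nth_nil.
rewrite rev_rcons /= nth_set_nth /= size_rcons -(addn1 (size l)) iotaD filter_cat /=.
rewrite nth_rcons ltnn eqxx size_rev !IH add0n.
have E : [seq m <- iota 0 (size l) | nth 0 (rcons l x) m == k] =
         [seq m <- iota 0 (size l) | nth 0 l m == k].
  by apply: eq_in_filter => m; rewrite mem_iota add0n nth_rcons => /andP[_ ->].
by rewrite E eq_sym; case: eqP => [<-|]; rewrite ?cats0 ?cats1.
Qed.

Lemma size_recording l : size (recording l) = \max_(k <- l) k.+1.
Proof. by elim: l => [|k l IH]; rewrite ?big_nil // big_cons /= size_set_nth IH. Qed.

Lemma recording_inj l l' : size l = size l' ->
  recording (rev l) = recording (rev l') -> l = l'.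
Proof.
move=> sz E; apply: (@eq_from_nth _ 0) => // m lm.
have : m \in nth [::] (recording (rev l)) (nth 0 l m).
  by rewrite nth_recording mem_filter eqxx mem_iota.
by rewrite E nth_recording mem_filter => /andP[/eqP].
Qed.

Lemma key_cols_rcons b m : key_cols (rcons b m) = key_cols b ++ iota 0 m.
Proof. by rewrite -cats1 key_cols_cat /key_cols /= cats0. Qed.

(** Block v visits column k once if k < b_v, with its letter of index k, and it starts after the
    letters of the earlier blocks. *)
Lemma key_cols_positions b k :
  [seq m <- iota 0 (sumn b) | nth 0 (key_cols b) m == k] =
  [seq sumn (take v b) + k | v <- iota 0 (size b) & k < nth 0 b v].
Proof.
elim/last_ind: b => // b m IH.
rewrite key_cols_rcons sumn_rcons size_rcons iotaD add0n -(addn1 (size b)) iotaD add0n.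
rewrite !filter_cat map_cat; congr cat.
  have -> : [seq x <- iota 0 (sumn b) | nth 0 (key_cols b ++ iota 0 m) x == k] =
            [seq x <- iota 0 (sumn b) | nth 0 (key_cols b) x == k].
    apply: eq_in_filter => x; rewrite mem_iota add0n => /andP[_ xb].
    by rewrite nth_cat size_key_cols xb.
  rewrite IH; have <- : [seq v <- iota 0 (size b) | k < nth 0 (rcons b m) v] =
                        [seq v <- iota 0 (size b) | k < nth 0 b v].
    by apply: eq_in_filter => x; rewrite mem_iota add0n nth_rcons => /andP[_ ->].
  apply/eq_in_map => v; rewrite mem_filter mem_iota add0n => /and3P[_ _ vb].
  by rewrite -cats1 takel_cat // ltnW.
rewrite /= nth_rcons ltnn eqxx (_ : iota (sumn b) m = map (addn (sumn b)) (iota 0 m)) ?filter_map;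
  last by rewrite -iotaDl addn0.
have -> : [seq x <- iota 0 m | preim (addn (sumn b))
    (fun x => nth 0 (key_cols b ++ iota 0 m) x == k) x] = [seq x <- iota 0 m | x == k].
  apply: eq_in_filter => x; rewrite mem_iota add0n => /andP[_ xm] /=.
  by rewrite nth_cat size_key_cols ltnNge leq_addr /= addKn nth_iota.
case: ltnP => km.
  by rewrite filter_pred1_uniq ?iota_uniq ?mem_iota //= -cats1 take_size_cat.
rewrite (_ : filter _ _ = [::]) //; apply/eqP; rewrite -[_ == _]negbK -has_filter.
by apply/hasP => -[x]; rewrite mem_iota add0n => /andP[_ xm] /eqP ex; lia.
Qed.

Lemma count_lt_key b v : count (fun w => w < v) (flatten (key b)) = sumn (take v b).
Proof.
elim: v => [|v IH]; first by rewrite take0 (eq_count (a2 := pred0)) ?count_pred0.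
have -> : count (fun w => w < v.+1) (flatten (key b)) =
    count (fun w => w < v) (flatten (key b)) + count_mem v (flatten (key b)).
  rewrite -count_predUI [count (predI _ _) _](eq_count (a2 := pred0)) ?count_pred0 ?addn0.
    by apply: eq_count => w; rewrite /= ltnS leq_eqVlt orbC.
  by move=> w /=; case: eqP => [->|]; rewrite ?ltnn ?andbF.
rewrite IH key_has_weight; case: (ltnP v (size b)) => vb.
  by rewrite (take_nth 0 vb) sumn_rcons.
by rewrite nth_default // addn0 !take_oversize // ltnW.
Qed.

Lemma count_take_key b v k : k <= nth 0 b v ->
  count_mem v (flatten (take k (key b))) = k.
Proof.
move=> kb; have kK : k <= size (key b).
  by rewrite size_mkseq; apply: leq_trans kb (nth_leq_max b v).
elim: k kb kK => [|k IH] kb kK; first by rewrite take0.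
rewrite (take_nth [::] kK) flatten_rcons count_cat IH ?(ltnW kb) ?(ltnW kK) //.
rewrite count_uniq_mem ?mem_key ?kb ?addn1 //.
exact/(sorted_uniq ltn_trans ltnn)/key_column_sorted.
Qed.

(** In both tableaux column k consists of the numbers b_0 + ... + b_(v-1) + k for the v with k <
    b_v. *)
Lemma recording_key b : recording (rev (key_cols b)) = std (key b).
Proof.
have sz : size (recording (rev (key_cols b))) = \max_(m <- b) m.
  rewrite size_recording (perm_big (key_cols b)) /=; last by rewrite perm_rev.
  rewrite big_flatten big_map; apply: eq_bigr => m _.
  elim: m => [|m IH]; first by rewrite big_nil.
  by rewrite -addn1 iotaD big_cat big_seq1 IH add0n addn1; apply/maxn_idPr.
apply: (@eq_from_nth _ [::]); first by rewrite sz !size_mkseq.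
move=> k; rewrite sz => kb; rewrite nth_recording size_key_cols key_cols_positions.
rewrite nth_mkseq ?size_mkseq //.
have -> : nth [::] (key b) k = [seq v <- iota 0 (size b) | k < nth 0 b v] by rewrite nth_mkseq.
apply/eq_in_map => v; rewrite mem_filter => /andP[kv _].
by rewrite count_lt_key count_take_key // ltnW.
Qed.

Lemma col_RS_key b s : size s = sumn b ->
  ((col_RS (rev s)).2 == std (key b)) = (cols [::] s == key_cols b).
Proof.
move=> sz; rewrite col_RS_rev -recording_key /=; apply/eqP/eqP => [|-> //].
by apply: recording_inj; rewrite size_cols size_key_cols.
Qed.

(** * Decomposition into strings *)

Section Strings.

Variable i : nat.
Local Notation q := (nclose i).
Local Notation p := (nopen i).
Local Notation f := (fop i).
Local Notation e := (eop i).

Lemma iter_fop s k : k <= p s ->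
  [/\ q (iter k f s) = q s + k, p (iter k f s) = p s - k & iter k e (iter k f s) = s].
Proof.
elim: k => [|k IH] kp; first by rewrite addn0 subn0.
have [qk pk ek] := IH (ltnW kp).
have pos : 0 < p (iter k f s) by rewrite pk subn_gt0.
rewrite [iter k.+1 e _]iterSr iterS fopK // nclose_fop // nopen_fop // ek qk pk.
by split=> //; lia.
Qed.

Lemma iter_eop s k : k <= q s ->
  [/\ q (iter k e s) = q s - k, p (iter k e s) = p s + k & iter k f (iter k e s) = s].
Proof.
elim: k => [|k IH] kq; first by rewrite addn0 subn0.
have [qk pk fk] := IH (ltnW kq).
have pos : 0 < q (iter k e s) by rewrite qk subn_gt0.
have [pe qe fe] := eop_sig pos.
rewrite [iter k.+1 f _]iterSr iterS fe pe qe fk qk pk; split=> //; lia.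
Qed.

Lemma count_fop s : 0 < p s -> forall x,
  count_mem x (f s) + (x == i) = count_mem x s + (x == i.+1).
Proof.
case/fop_split=> s1 [s2 [-> -> _ _]] x; rewrite !count_cat /=.
by rewrite [i == x]eq_sym [i.+1 == x]eq_sym; lia.
Qed.

Lemma count_iter_fop s k : k <= p s -> forall x,
  count_mem x (iter k f s) + k * (x == i) = count_mem x s + k * (x == i.+1).
Proof.
elim: k => [|k IH] kp x; first by rewrite !mul0n.
have [_ pk _] := iter_fop (ltnW kp).
have pos : 0 < p (iter k f s) by rewrite pk subn_gt0.
have := count_fop pos x; have := IH (ltnW kp) x.
rewrite iterS !mulSn; lia.
Qed.

(** A set closed under e is a disjoint union of initial segments of strings, m h being the length of
    the segment that starts at the highest word h. The pair (h, k) is recovered from f^k h: the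
    number of unmatched i + 1 is k, and e^k leads back to h. *)
Lemma perm_strings (L : seq (seq nat)) (m : seq nat -> nat) : uniq L ->
    (forall s, s \in L -> 0 < q s -> e s \in L) ->
    (forall h, h \in L -> q h = 0 ->
       m h <= (p h).+1 /\ forall k, k <= p h -> (iter k f h \in L) = (k < m h)) ->
  perm_eq L [seq iter k f h | h <- [seq h <- L | q h == 0], k <- iota 0 (m h)].
Proof.
move=> uL eL mP.
have kp h k : h \in L -> q h = 0 -> k < m h -> k <= p h.
  by move=> hL qh km; have [mp _] := mP h hL qh; rewrite -ltnS (leq_trans km).
apply: uniq_perm => //.
  apply: allpairs_uniq_dep; first exact: filter_uniq.
    by move=> h _; apply: iota_uniq.
  move=> _ _ /allpairsPdep[h [k [+ + ->]]] /allpairsPdep[h' [k' [+ + ->]]] /=.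
  rewrite !mem_filter !mem_iota !add0n => /andP[/eqP qh hL] km /andP[/eqP qh' hL'] km' E.
  have [q1 _ e1] := iter_fop (kp h k hL qh km).
  have [q2 _ e2] := iter_fop (kp h' k' hL' qh' km').
  have ek : k = k' by move: q1; rewrite E q2 qh qh' => /esym.
  by rewrite -ek in E e2 *; rewrite -e1 -e2 E.
move=> s; apply/idP/allpairsPdep => [sL|[h [k []]]]; last first.
  rewrite mem_filter mem_iota add0n => /andP[/eqP qh hL] km ->.
  by have [_ mE] := mP h hL qh; rewrite mE // kp.
(* The highest word of the string of s is reached by applying e as often as there are unmatched i +
   1. *)
have [q1 p1 f1] := iter_eop (leqnn (q s)).
have hL : iter (q s) e s \in L.
  have : q s <= q s by [].
  elim: {1 3}(q s) => //= k IH kq; have [qk _ _] := iter_eop (ltnW kq).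
  by apply: eL; [apply: IH; exact: ltnW | rewrite qk subn_gt0].
have qh : q (iter (q s) e s) = 0 by rewrite q1 subnn.
exists (iter (q s) e s), (q s); split; rewrite ?f1 // ?mem_filter ?qh //.
have [_ mE] := mP _ hL qh.
by rewrite mem_iota add0n -mE ?f1 // p1 leq_addl.
Qed.

End Strings.

Import GRing.Theory.
Local Open Scope ring_scope.

(** * Demazure operators on the characters of strings *)

Section Characters.

Variable n : nat.
Local Notation R := {mpoly int[n]}.

Definition content (s : seq nat) : R := 'X_[[multinom count_mem (val k) s | k < n]].

Lemma content_perm s s' : perm_eq s s' -> content s = content s'.
Proof.
by move=> E; congr 'X_[_]; apply/mnmP => k; rewrite !mnmE; apply/seq.permP.
Qed.

Lemma content_word (w : seq 'I_n) : content [seq val x | x <- w] = word_monomial w.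
Proof.
elim: w => [|x w IH]; rewrite /word_monomial ?big_nil ?big_cons.
  by rewrite -mpolyX0; congr 'X_[_]; apply/mnmP => k; rewrite !mnmE.
rewrite -/(word_monomial w) -IH -mpolyXD; congr 'X_[_]; apply/mnmP => k.
by rewrite mnmDE mnm1E !mnmE /= val_eqE.
Qed.

Variables i j : 'I_n.
Hypothesis ji : j = i.+1 :> nat.

Local Notation p := (nopen i).
Local Notation f := (fop i).

Lemma content_fop s : (0 < p s)%N -> 'X_i * content (f s) = 'X_j * content s.
Proof.
move=> ps; rewrite -!mpolyXD; congr 'X_[_]; apply/mnmP => k.
rewrite !mnmDE !mnm1E !mnmE -!val_eqE /= ji.
have /= := count_fop ps k; rewrite ![nat_of_ord k == _]eq_sym; lia.
Qed.

(** A highest word has [p s] more letters i than i + 1, so changing [p s] of them exchanges the two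
    multiplicities. *)
Lemma content_string_end s : nclose i s = 0%N ->
  content (iter (p s) f s) = msym (tperm i j) (content s).
Proof.
move=> qs; rewrite /content msymX tpermV; congr 'X_[_]; apply/mnmP => k.
have ij : (i == j :> nat) = false by rewrite ji; lia.
rewrite !mnmE; have /= := count_iter_fop (leqnn (p s)) k.
have := count_brackets i s; rewrite qs -ji.
case: tpermP => [->|->|/eqP + /eqP +]; rewrite -?val_eqE /=.
- by rewrite ij eqxx; lia.
- by rewrite eq_sym ij eqxx; lia.
by move=> /negbTE -> /negbTE ->; lia.
Qed.

(** The numerator of the Demazure operator; identities are proved for it and x_i - x_j is cancelled
    at the end. *)
Definition antisym (g : R) : R := 'X_i * g - 'X_j * msym (tperm i j) g.

Lemma msym_tpermX : msym (tperm i j) 'X_i = 'X_j :> R.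
Proof.
rewrite msymX tpermV; congr 'X_[_]; apply/mnmP=> l; rewrite mnmE !mnm1E.
by rewrite -(can2_eq (tpermK i j) (tpermK i j)) tpermL.
Qed.

Lemma demazureP g : ('X_i - 'X_j) * demazure i j g = antisym g.
Proof. by rewrite /demazure divdiffP msymM msym_tpermX. Qed.

Lemma antisym_sum (I : Type) (r : seq I) (F : I -> R) :
  antisym (\sum_(x <- r) F x) = \sum_(x <- r) antisym (F x).
Proof.
by rewrite /antisym raddf_sum !mulr_sumr -sumrB.
Qed.

(** As x_i x^(f s) = x_j x^s, the product telescopes to x_i x^s - x_j x^t with t the end of the
    string, whose content is given by [content_string_end]. *)
Lemma string_telescope s : nclose i s = 0%N ->
  ('X_i - 'X_j) * (\sum_(k <- iota 0 (p s).+1) content (iter k f s)) =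
  antisym (content s).
Proof.
move=> qs; have tele m : (m <= p s)%N ->
    ('X_i - 'X_j) * (\sum_(k <- iota 0 m) content (iter k f s)) =
    'X_i * content s - 'X_i * content (iter m f s).
  elim: m => [|m IH] mp; first by rewrite big_nil mulr0 subrr.
  rewrite -[in iota _ _]addn1 iotaD big_cat big_seq1 mulrDr IH ?(ltnW mp) //= add0n.
  rewrite content_fop; last by have [_ -> _] := iter_fop (ltnW mp); rewrite subn_gt0.
  by rewrite mulrBl addrA subrK.
rewrite -addn1 iotaD big_cat big_seq1 mulrDr tele // add0n mulrBl addrA subrK.
by rewrite content_string_end.
Qed.

Lemma mpolyX_sub_neq0 : 'X_i - 'X_j != 0 :> R.
Proof.
rewrite subr_eq0; apply/eqP => /(congr1 (fun g : R => g@_U_(i))).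
rewrite !mcoeffX eqxx; case: eqP => // /mnmP /(_ i); rewrite !mnm1E eqxx.
by rewrite -val_eqE /= ji; case: eqP => //; lia.
Qed.

(* The sum of a complete string is symmetric, so that antisym acts on it as the
   multiplication by x_i - x_j. *)
Lemma antisym_string s : nclose i s = 0%N ->
  antisym (\sum_(k <- iota 0 (p s).+1) content (iter k f s)) = antisym (content s).
Proof.
move=> qs; have E := string_telescope qs; set F := \sum_(k <- _) _ in E *.
have sjX : msym (tperm i j) 'X_j = 'X_i :> R.
  by rewrite -msym_tpermX -msymMm tperm2 msym1m.
suff sF : msym (tperm i j) F = F by rewrite -E /antisym sF mulrBl.
(* The exchange of the variables changes the sign of x_i - x_j and of its product with F, so it
   fixes F. *)
apply: (mulfI mpolyX_sub_neq0); apply: oppr_inj.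
have := congr1 (msym (tperm i j)) E.
rewrite msymM msymB msym_tpermX sjX -mulNr opprB => ->.
rewrite E /antisym msymB !msymM msym_tpermX sjX -msymMm tperm2 msym1m.
by rewrite opprB.
Qed.

End Characters.

Lemma lift_ordinals n s : all (fun x => x < n)%N s -> exists w : seq 'I_n, s = [seq val x | x <- w].
Proof.
elim: s => [|x s IH] /= => [_|/andP[xn /IH[w ->]]]; first by exists [::].
by exists (Ordinal xn :: w).
Qed.

(** * The recursion of key polynomials *)

Section KeyPolynomial.

Variable n : nat.
Implicit Types b : n.-tuple nat.

Definition key_words b : seq (seq nat) :=
  [seq s <- [seq map val (tval w) | w <- enum {: (sumn b).-tuple 'I_n}] | flagged_key b s].

Lemma key_words_uniq b : uniq (key_words b).
Proof.
apply: filter_uniq; rewrite map_inj_uniq ?enum_uniq // => w w' /(inj_map val_inj).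
exact: val_inj.
Qed.

Lemma mem_key_words b s : (s \in key_words b) = flagged_key b s.
Proof.
rewrite mem_filter; case: (boolP (flagged_key b s)) => //= fs.
have [|w Es] := @lift_ordinals n s; first by have := flagged_key_lt fs; rewrite size_tuple.
have sz : size w == sumn b by rewrite -(flagged_key_size fs) Es size_map.
apply/mapP; by exists (Tuple sz); rewrite ?mem_enum.
Qed.

Lemma swap_adjacent b (i j : 'I_n) : j = i.+1 :> nat -> exists (b1 : seq nat) p q (b2 : seq nat),
  [/\ b = b1 ++ p :: q :: b2 :> seq nat, swap i j b = b1 ++ q :: p :: b2 :> seq nat,
      size b1 = i, p = tnth b i & q = tnth b j].
Proof.
move=> ji; exists (take i b), (tnth b i), (tnth b j), (drop j.+1 b).
have szi : size (take i b) = i by rewrite size_takel // size_tuple ltnW.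
have szb : size b = n by rewrite size_tuple.
have E : b = take i b ++ tnth b i :: tnth b j :: drop j.+1 b :> seq nat.
  rewrite -[LHS](cat_take_drop i) !(tnth_nth 0%N) -drop_nth ?szb // [in drop j b]ji.
  by rewrite -drop_nth ?szb.
split=> //; apply: (@eq_from_nth _ 0%N) => [|k].
  by rewrite size_tuple -[LHS]szb {1}E !size_cat.
rewrite size_tuple => kn; have [o ->] : exists o : 'I_n, k = o by exists (Ordinal kn).
rewrite -tnth_nth tnth_mktuple nth_cat szi; case: tpermP => [->|->|/eqP + /eqP +].
- by rewrite ltnn subnn.
- by rewrite ji ltnNge leqnSn subSnn.
rewrite -!val_eqE /= ji => /eqP oi /eqP oj; rewrite (tnth_nth 0%N) {1}E nth_cat szi.
case: ltnP => // io; have [m ->] : exists m, (o - i = m.+2)%N by exists (o - i - 2)%N; lia.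
by rewrite /= ji.
Qed.

(** The content depends only on the insertion tableau, and a tableau comes from at most one word
    because the recording tableau is prescribed. By [flagged_key_swap], used in both directions, the
    highest words on the two sides have the same tableaux. *)
Lemma sum_highest b (i j : 'I_n) : j = i.+1 :> nat ->
  \sum_(h <- [seq h <- key_words b | nclose i h == 0%N]) antisym i j (content n h) =
  \sum_(h <- [seq h <- key_words (swap i j b) | nclose i h == 0%N]) antisym i j (content n h).
Proof.
move=> ji; have [b1 [p [q [b2 [Eb Ec szi _ _]]]]] := swap_adjacent b ji.
set c := swap i j b in Ec *.
have viaP (r : seq (seq nat)) : \sum_(h <- r) antisym i j (content n h) =
    \sum_(T <- [seq insw [::] h | h <- r]) antisym i j (content n (reading T)).
  rewrite big_map; apply: eq_bigr => h _; congr antisym; apply: content_perm.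
  by rewrite perm_sym; apply: reading_insw.
rewrite !viaP; apply: perm_big; apply: uniq_perm.
- rewrite map_inj_in_uniq ?(filter_uniq _ (key_words_uniq _)) // => h h'.
  rewrite (mem_filter _ h) (mem_filter _ h') !mem_key_words => /andP[_ hb] /andP[_ hb'].
  exact: flagged_key_inj hb hb'.
- rewrite map_inj_in_uniq ?(filter_uniq _ (key_words_uniq _)) // => h h'.
  rewrite (mem_filter _ h) (mem_filter _ h') !mem_key_words => /andP[_ hb] /andP[_ hb'].
  exact: flagged_key_inj hb hb'.
have sub (u v : n.-tuple nat) p' q' : u = b1 ++ p' :: q' :: b2 :> seq nat ->
    v = b1 ++ q' :: p' :: b2 :> seq nat ->
    {subset [seq insw [::] h | h <- key_words u & nclose i h == 0%N] <=
            [seq insw [::] h | h <- key_words v & nclose i h == 0%N]}.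
  move=> Eu Ev _ /mapP[h + ->]; rewrite mem_filter mem_key_words Eu => /andP[/eqP qh fh].
  rewrite -szi in qh; have [h' [fh' qh' <-]] := flagged_key_swap qh fh.
  by apply: map_f; rewrite mem_filter mem_key_words Ev fh' -szi qh'.
by move=> T; apply/idP/idP; [exact: (sub _ _ _ _ Eb Ec) | exact: (sub _ _ _ _ Ec Eb)].
Qed.

(** At a weak ascent the words form complete strings, each of which telescopes. *)
Lemma key_words_ascent b (i j : 'I_n) : j = i.+1 :> nat -> (tnth b i <= tnth b j)%N ->
  ('X_i - 'X_j) * (\sum_(s <- key_words b) content n s) =
  \sum_(h <- [seq h <- key_words b | nclose i h == 0%N]) antisym i j (content n h).
Proof.
move=> ji bij; have [b1 [p [q [b2 [Eb _ szi Ep Eq]]]]] := swap_adjacent b ji.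
rewrite (perm_big _ (@perm_strings i _ (fun h => (nopen i h).+1) (key_words_uniq b) _ _)).
- rewrite big_allpairs_dep mulr_sumr; apply: eq_big_seq => h.
  by rewrite mem_filter => /andP[/eqP qh _]; apply: string_telescope.
- by move=> s; rewrite !mem_key_words => fs qs; apply: flagged_key_eop.
move=> h hb qh; split=> // k kp; rewrite ltnS kp; elim: k kp => // k IH kp.
have [_ pk _] := iter_fop (ltnW kp).
move: (IH (ltnW kp)); rewrite !mem_key_words Eb -szi iterS; apply: flagged_key_fop_ascent.
  by rewrite Ep Eq.
by rewrite szi pk subn_gt0.
Qed.

(* Without the order of the parts, a string that meets the words may do so only
   in its highest element. *)
Lemma key_words_descent b (i j : 'I_n) : j = i.+1 :> nat ->
  antisym i j (\sum_(s <- key_words b) content n s) =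
  \sum_(h <- [seq h <- key_words b | nclose i h == 0%N]) antisym i j (content n h).
Proof.
move=> ji; pose m h := if fop i h \in key_words b then (nopen i h).+1 else 1%N.
have eb s : s \in key_words b -> (0 < nclose i s)%N -> eop i s \in key_words b.
  by rewrite !mem_key_words => fs qs; apply: flagged_key_eop.
rewrite (perm_big _ (@perm_strings i _ m (key_words_uniq b) eb _)).
  rewrite big_allpairs_dep antisym_sum; apply: eq_big_seq => h.
  rewrite mem_filter => /andP[/eqP qh _]; rewrite /m; case: ifP => _.
    exact: antisym_string.
  by rewrite big_seq1.
move=> h hb qh; rewrite /m; case: ifP => fh; split=> // k kp.
  rewrite ltnS kp; elim: k kp => // -[|k] // IH kp.
  (* From its second word on, the string has an unmatched i + 1, so [flagged_key_fop] keeps it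
     inside. *)
  have [qk pk _] := iter_fop (ltnW kp).
  move: (IH (ltnW kp)); rewrite !mem_key_words [iter k.+2 _ _]iterS; apply: flagged_key_fop.
    by rewrite qk addnS.
  by rewrite pk subn_gt0.
case: k kp => [|k] kp; first by rewrite hb.
apply/negP; elim: k kp => [|k IH] kp; first by rewrite /= fh.
(* Climbing back by e from a later word of the string would lead to [fop i h], which is excluded. *)
have [qk _ _] := iter_fop kp; have [_ pk _] := iter_fop (ltnW kp).
move/eb; rewrite qk addnS => /(_ isT); rewrite iterS fopK; last by rewrite pk subn_gt0.
exact/IH/ltnW.
Qed.

Lemma count_row_index k (b : seq nat) v :
  count_mem v (row_index k b) = if (k <= v)%N then nth 0%N b (v - k) else 0%N.
Proof.
elim: b k => [|m b IH] k /=; first by rewrite nth_nil if_same.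
rewrite count_cat IH count_nseq /=; case: (ltngtP k v) => kv.
- by have -> : (v - k = (v - k.+1).+1)%N by lia.
- by rewrite mul0n.
by rewrite kv subnn mul1n addn0.
Qed.

Theorem key_poly_words b : key_poly b = \sum_(s <- key_words b) content n s.
Proof.
have [N] := ubnP (ninv b); elim: N b => // N IH b; rewrite ltnS => bN.
rewrite key_polyE; case Ea: (ascent b) => [[i j]|]; last first.
  have sb : sorted geq b.
    apply/(sortedP 0%N) => k; rewrite size_tuple => kn /=; rewrite leqNgt; apply/negP => lt.
    move: Ea; rewrite /ascent; case: pickP => // /(_ (Ordinal (ltnW kn), Ordinal kn)).
    by rewrite /= !(tnth_nth 0%N) /= eqxx lt.
  rewrite (perm_big [:: row_index 0 b]).
    rewrite big_seq1 /content; congr 'X_[_]; apply/mnmP => k.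
    by rewrite mnmE count_row_index subn0 /= -tnth_nth /mnm_tnth.
  apply: uniq_perm; rewrite ?key_words_uniq // => s.
  by rewrite mem_key_words flagged_key_decreasing // inE.
have [ji bij] := ascentP Ea.
(* After multiplication by x_i - x_j, both sides become sums over highest words. *)
apply: (mulfI (mpolyX_sub_neq0 ji)); rewrite demazureP key_words_ascent ?(ltnW bij) //.
rewrite IH; last by apply: leq_trans bN; exact: ninv_swap.
by rewrite (key_words_descent _ ji); apply/esym/sum_highest.
Qed.

End KeyPolynomial.

(** * Translation to Young words *)

Lemma all2_row_index k sh s : size s = sumn sh ->
  reflect (forall x, (x < size sh)%N -> all (geq (k + x)%N) (nth [::] (reshape sh s) x))
          (all2 leq s (row_index k sh)).
Proof.
elim: sh k s => [|m sh IH] k s /=; first by case: s => // _; constructor.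
move=> sz; have szt : size (take m s) = m by rewrite size_takel // sz leq_addr.
rewrite -[X in all2 _ X _](cat_take_drop m s) all2_cat ?size_nseq // all2_nseq szt eqxx /=.
apply: (iffP andP) => [[h1 /IH h2] [|x] /=|h]; first by rewrite addn0.
  by rewrite ltnS -addSnnS; apply: h2; rewrite size_drop sz addKn.
split; first by have := h 0%N isT; rewrite addn0.
by apply/IH => [|x xs]; [rewrite size_drop sz addKn | have := h x.+1 xs; rewrite addnS -addSn].
Qed.

Lemma key_cols_sorted T sh s x : valid T -> cols T s = key_cols sh ->
  sorted geq (nth [::] (reshape sh s) x).
Proof.
elim: sh T s x => [|m sh IH] T s x vT /= C; first by rewrite nth_nil.
have szt : size (take m s) = m.
  by rewrite size_takel // -(size_cols T) C size_cat size_iota leq_addr.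
move: C; rewrite -{1}(cat_take_drop m s) cols_cat => /eqP.
rewrite eqseq_cat ?size_cols ?szt ?size_iota // => /andP[/eqP C1 /eqP C2].
case: x => [|x] /=; first by rewrite -(cols_row _ vT) C1 iota_ltn_sorted.
by apply: IH C2; apply: insw_valid.
Qed.

Section YoungWords.

Variables (n : nat) (a : n.-tuple nat).

Definition complement (u : seq 'I_n) : seq nat := [seq val (rev_ord x) | x <- u].

(** The factors of u are numbered from the right and the blocks from the left, hence the reversed
    index. *)
Lemma factor_complement (u : (sumn a).-tuple 'I_n) i :
  complement (factor a u i) = nth [::] (reshape (rev a) (complement u)) (rev_ord i).
Proof.
have sz : size (reshape (rev a) u) = n by rewrite size_reshape size_rev size_tuple.
rewrite /factor nth_rev ?sz // /complement -map_reshape (nth_map [::]) //.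
by rewrite sz rev_ord_proof.
Qed.

(** Column insertion starts at the end of frev u, so it reads the complement of u from left to
    right. Complementing turns increasing rows into decreasing ones and the lower bound on factor i
    into the upper bound on block n - 1 - i. *)
Lemma YW_flagged_key (u : (sumn a).-tuple 'I_n) :
  (u \in YW a) = flagged_key (rev a) (complement u).
Proof.
have szs : size (complement u) = sumn (rev a) by rewrite size_map size_tuple sumn_rev.
have -> : (u \in YW a) = [&& [forall i : 'I_n, sorted (fun j k : 'I_n => j <= k)%N (factor a u i)],
    cols [::] (complement u) == key_cols (rev a)
  & [forall i : 'I_n, all (fun j : 'I_n => i <= j)%N (factor a u i)]].
  rewrite inE -col_RS_key //; congr [&& _, (_ : tableau) == _ & _].
  by rewrite /complement /frev !map_rev -map_comp.
have srtE (v : seq 'I_n) : sorted (fun j k : 'I_n => j <= k)%N v = sorted geq (complement v).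
  rewrite /complement sorted_map; apply: eq_sorted => x y /=.
  by have := ltn_ord x; have := ltn_ord y; lia.
apply/and3P/andP => [[_ -> fl]|[C fl]]; split=> //.
- apply/all2_row_index => // x; rewrite size_rev size_tuple add0n => xn.
  pose i := rev_ord (Ordinal xn).
  have -> : x = rev_ord i by rewrite rev_ordK.
  rewrite -factor_complement all_map; apply: sub_all (forallP fl i) => y /= iy.
  by have := ltn_ord y; have := ltn_ord i; lia.
- apply/forallP => i; rewrite srtE factor_complement.
  exact: (@key_cols_sorted [::]) isT (eqP C).
apply/forallP => i; move/all2_row_index: fl => /(_ szs (rev_ord i)).
rewrite size_rev size_tuple ltn_ord add0n -factor_complement all_map => /(_ isT).
apply: sub_all => y /=.
by have := ltn_ord y; have := ltn_ord i; lia.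
Qed.

End YoungWords.

Theorem mainTheorem4 (n : nat) (a : n.-tuple nat) :
  young_key_poly a = \sum_(w in YW a) word_monomial w.
Proof.
rewrite /young_key_poly key_poly_words.
rewrite (perm_big [seq complement (tval w) | w <- enum (YW a)]); last first.
  apply: uniq_perm; first exact: key_words_uniq.
    rewrite map_inj_uniq ?enum_uniq // => w w' E; apply: val_inj.
    by apply: (inj_map (f := fun x : 'I_n => val (rev_ord x))) E => x y /val_inj /rev_ord_inj.
  move=> s; rewrite mem_key_words; apply/idP/mapP => [fs|[w]]; last first.
    by rewrite mem_enum YW_flagged_key => ? ->.
  have [|w Es] := @lift_ordinals n s.
    by have := flagged_key_lt fs; rewrite size_rev size_tuple.
  have sz : size [seq rev_ord x | x <- w] == sumn a.
    by rewrite size_map -sumn_rev -(flagged_key_size fs) Es size_map.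
  have Ec : s = complement (tval (Tuple sz)).
    by rewrite Es /complement /= -map_comp; apply: eq_map => x /=;
       rewrite -[RHS]/(val (rev_ord (rev_ord x))) rev_ordK.
  by exists (Tuple sz); rewrite // mem_enum YW_flagged_key -Ec.
(* The substitution reversing the variables undoes the complement of the letters in each
   monomial. *)
rewrite big_map -big_enum raddf_sum; apply: eq_bigr => w _.
have -> : complement (tval w) = [seq val x | x <- [seq rev_ord x | x <- tval w]].
  by rewrite -map_comp.
rewrite content_word /word_monomial big_map /= rmorph_prod.
apply: eq_bigr => x _; rewrite /= comp_mpolyXU.
by rewrite -tnth_nth tnth_mktuple rev_ordK.
Qed.
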